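(* For every $n \geq 2$ and $a \in \mathcal A_n$, $\widehat\Psi([\mathcal D, a]) = V(\widehat\Psi a)$, as functions on $X$.
   Context: Setting. $X$ is a $C^\infty$ manifold and $\Phi^t \colon X \to X$, $t \in \mathbb R$, is a flow generated by a $C^\infty$ vector field $\vec V$, with derivation $Vf = \vec V \cdot \nabla f$ on $C^\infty(X)$. $\mathcal H \subset C^\infty(X)$ is a complex reproducing kernel Hilbert space (RKHS) with strictly positive-definite kernel $k$ and kernel sections $k_x = k(x,\cdot)$, so $f(x) = \langle k_x, f\rangle_{\mathcal H}$ (inner products conjugate-linear in the first argument). As an unbounded operator on $\mathcal H$, $V$ has domain $\{f \in \mathcal H : Vf \in \mathcal H\}$; $V^*$ is its adjoint. Standing assumption 1. (a) $V \colon \mathcal H \to C(X)$ is continuous for the compact-open topology on $C(X)$. (b) $\mathcal H_\infty \subseteq \mathrm{dom}(V) \cap \mathrm{dom}(V^* )$ is a dense subspace of $\mathcal H$ invariant under $V$ and $V^*$. (c) With $V_1 = V$, $V_2 = V^*$, for every $f \in \mathcal H_\infty$ the series $\sum_{n=0}^\infty \frac{z^n}{n!} \sum_{\epsilon \colon [n] \to [2]} \lVert V_{\epsilon(1)} \cdots V_{\epsilon(n)} f \rVert_{\mathcal H}$ has a strictly positive radius of convergence, where $[n]=\{1,\dots,n\}$. Standing assumption 2. $\mathcal H$ is a reproducing kernel Hilbert algebra: $k_x \mapsto k_x \otimes k_x$ extends to a bounded linear map $\mathcal H \to \mathcal H \otimes \mathcal H$. $\mathcal S \subset \mathcal H_\infty$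 is a finite-dimensional subspace such that the subalgebra generated by $\mathcal S$ is dense in $\mathcal H$. Standing assumption 3. $\lVert k_x\rVert_{\mathcal H} = 1$ for all $x \in X$. First amplification. On $\mathcal H_\infty$, $A = (V-V^* )/2$, $S = (V+V^* )/2$. $\mathfrak H = \ell^2(\mathbb N) \otimes \mathcal H$, $\mathfrak H_0 = C_c(\mathbb N) \otimes_{\mathrm{alg}} \mathcal H_\infty$, $e_i$ is the canonical basis of $\ell^2(\mathbb N)$, $e_{i,j}$ the matrix units ($e_{i,j}e_j = e_i$), and $L = \sum_{i\ge 1} (e_{i,i+1} \otimes S + e_{i,i} \otimes A - e_{i+1,i} \otimes S)$ on $\mathfrak H_0$. $E_n f = \sum_{i=1}^n F_i\, e_i \otimes f$ with $F_i$ the Fibonacci numbers ($F_1=F_2=1$), $E_n\colon \mathcal H \to \mathfrak H$. Fock space. $\mathfrak H^{\vee n}$ is the closed subspace of symmetric tensors in $\mathfrak H^{\otimes n}$ ($\mathfrak H^{\vee 0} = \mathbb C$); $u_1 \vee \cdots \vee u_n = \frac1{n!}\sum_{\sigma \in S_n} u_{\sigma(1)} \otimes \cdots \otimes u_{\sigma(n)}$. $\mathfrak F$ is the Hilbert space completion of $\bigoplus_{n\ge0} (\mathfrak H^{\vee n}, w(n)^2 \langle\cdot,\cdot\rangle_{\mathfrak H^{\vee n}})$, with weights $w(n) = e^{\tau n^p}$, $\tau>0$, $p \in (0,1)$; $\vee$ extends to a bounded bilinear commutative unital multiplication on $\mathfrak F$. $\mathcal D$ is the operator on $\mathfrak F$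 with domain the linear span of $1 \in \mathbb C$ and all $v_1 \vee\cdots\vee v_n$, $v_i \in \mathfrak H_0$, given by $\mathcal D 1 = 0$ and $\mathcal D(v_1 \vee \cdots \vee v_n) = \sum_i v_1 \vee \cdots \vee Lv_i \vee \cdots \vee v_n$ (it is essentially skew-adjoint). Operators and states. For $u \in \mathfrak H$, $a_u^* \in B(\mathfrak F)$ is $a_u^*\eta = u \vee \eta$ and $a_u$ is its adjoint. $\mathcal A_n \subset B(\mathfrak F)$ is the $*$-algebra generated by $\mathrm{Id}_{\mathfrak F}$ and $\{a_{E_nf} : f \in \mathcal S\}$; $\mathcal A_\infty \supset \mathcal A_n$ is the $*$-algebra generated by $\mathrm{Id}_{\mathfrak F}$ and $\{a_u : u \in \mathfrak H_0\}$; $\mathcal A$ is the $C^*$-algebra generated by $\mathcal A_\infty$. For $a \in \mathcal A_\infty$, $[\mathcal D,a] = \mathcal D a - a \mathcal D$ extends to a bounded operator (denoted the same) belonging to $\mathcal A_\infty$. For $x \in X$, $m \in \mathbb N$, $\mathcal K_x^{(m)} = \sum_{n=m}^\infty w(n)^{-2} (e_1 \otimes k_x)^{\vee n}$, $\varphi_x^m(a) = \langle \mathcal K_x^{(m)}, a \mathcal K_x^{(m)}\rangle_{\mathfrak F}/\lVert \mathcal K_x^{(m)}\rVert_{\mathfrak F}^2$, and $\Psi_x(a) = \lim_{m\to\infty} \varphi_x^m(a)$ for $a \in \mathcal A$; this limit exists and defines a state of $\mathcal A$. $(\widehat\Psi a)(x) = \Psi_x(a)$, which is a smooth function of $x$ for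 $a \in \mathcal A_\infty$. *)

(* Defs.v *)
From HB Require Import structures.
From mathcomp Require Import all_boot all_order all_algebra perm.
From mathcomp Require Import all_classical all_reals all_analysis.
From mathcomp Require Import complex.

Set Implicit Arguments.
Unset Strict Implicit.
Unset Printing Implicit Defensive.

Import Order.TTheory GRing.Theory Num.Theory numFieldNormedType.Exports.

#[global] Open Scope classical_set_scope.
#[global] Open Scope ring_scope.
#[global] Open Scope complex_scope.

(* MathComp-Analysis puts the norm topology on abstract numeric fields only;
   this makes it available on R[i]. *)
HB.instance Definition _ (R : realType) :=
  NormedModule.copy R[i] (R[i] : numClosedFieldType)^o.

Section Smooth.
Context {R : realType} {V W : normedModType R}.

Fixpoint Ck_on (n : nat) (U : set V) (f : V -> W) : Prop :=
  (forall x, U x -> {for x, continuous f}) /\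
  (if n is m.+1 then
     forall v, (forall x, U x -> derivable f x v) /\ Ck_on m U (fun x => 'D_v f x)
   else True).

Definition smooth_on (U : set V) (f : V -> W) : Prop := forall n, Ck_on n U f.

End Smooth.

(* A d-dimensional manifold: [param i] is the inverse of the chart [chart i],
   only meaningful on [chart i @` chart_dom i]; [chart_at x] is some chart around x. *)
Record smooth_manifold (R : realType) (d : nat) (X : topologicalType) :=
  SmoothManifold {
  manifold_hausdorff : hausdorff_space X;
  manifold_countable : @second_countable X;
  chart_index : Type;
  chart_dom : chart_index -> set X;
  chart : chart_index -> X -> 'rV[R]_d;
  param : chart_index -> 'rV[R]_d -> X;
  chart_dom_open : forall i, open (chart_dom i);
  chart_codom_open : forall i, open (chart i @` chart_dom i);
  chart_continuous : forall i x, chart_dom i x -> {for x, continuous (chart i)};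
  param_continuous : forall i x, chart_dom i x -> {for chart i x, continuous (param i)};
  chartK : forall i x, chart_dom i x -> param i (chart i x) = x;
  chart_at : X -> chart_index;
  chart_atP : forall x, chart_dom (chart_at x) x;
  transition_smooth : forall i j,
    smooth_on (chart i @` (chart_dom i `&` chart_dom j)) (chart j \o param i) }.

Section Manifold.
Context {R : realType} {d : nat} {X : topologicalType}.
Variable M : smooth_manifold R d X.

Definition smooth_fun {W : normedModType R} (f : X -> W) : Prop :=
  forall i : chart_index M, smooth_on (chart i @` chart_dom i) (f \o param i).

Definition smooth_cfun (f : X -> R[i]) : Prop :=
  smooth_fun (fun x => complex.Re (f x)) /\ smooth_fun (fun x => complex.Im (f x)).

(* [vf i x] is the coordinate vector, in the chart i, of the tangent vector at x. *)
Record vector_field := VectorField {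
  vf : chart_index M -> X -> 'rV[R]_d;
  vf_smooth : forall i, smooth_on (chart i @` chart_dom i) (vf i \o param i);
  vf_compat : forall i j x, chart_dom i x -> chart_dom j x ->
    'D_(vf i x) (chart j \o param i) (chart i x) = vf j x }.

Variable v : vector_field.

Definition der_real (f : X -> R) (x : X) : R :=
  let i := chart_at M x in 'D_(vf v i x) (f \o param i) (chart i x).

Definition der (f : X -> R[i]) (x : X) : R[i] :=
  der_real (fun y => complex.Re (f y)) x +i* der_real (fun y => complex.Im (f y)) x.

Record flow_generated_by (Phi : R -> X -> X) : Prop := FlowGeneratedBy {
  flow0 : forall x, Phi 0 x = x;
  flowD : forall s t x, Phi (s + t) x = Phi s (Phi t x);
  flow_continuous : forall x, continuous (fun t => Phi t x);
  flow_derive : forall x t (i : chart_index M), chart_dom i (Phi t x) ->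
    is_derive t 1 (fun s => chart i (Phi s x)) (vf v i (Phi t x)) }.

End Manifold.

HB.mixin Record CompleteNormedModule_isHilbert (R : realType) V
    of CompleteNormedModule R[i] V := {
  inner : V -> V -> R[i];
  inner_linear : forall a u v w, inner u (a *: v + w) = a * inner u v + inner u w;
  inner_conj : forall u v, inner v u = (inner u v)^*;
  inner_norm : forall u, inner u u = `|u| ^+ 2 }.

#[short(type="hilbertType")]
HB.structure Definition Hilbert (R : realType) :=
  {V of CompleteNormedModule_isHilbert R V & CompleteNormedModule R[i] V}.

Section Operators.
Context {R : realType}.

Definition linear_subspace {U : lmodType R[i]} (W : set U) : Prop :=
  W 0 /\ forall a u v, W u -> W v -> W (a *: u + v).

Definition lspan {U : lmodType R[i]} (G : set U) : set U :=
  smallest linear_subspace G.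

(* Possibly unbounded operators are represented by their graphs. *)
Definition opdom {U : Type} (T : set (U * U)) : set U :=
  [set u | exists w, T (u, w)].

Definition opapp {U : lmodType R[i]} (T : set (U * U)) (u : U) : U :=
  xget 0 [set w | T (u, w)].

Context {U : hilbertType R}.

Definition adjoint (T : set (U * U)) : set (U * U) :=
  [set p | forall f g, T (f, g) -> inner p.1 g = inner p.2 f].

Definition adj (a : U -> U) : U -> U := opapp (adjoint [set (u, a u) | u in setT]).

Definition star_alg (G : set (U -> U)) : set (U -> U) :=
  smallest [set W : set (U -> U) | [/\ linear_subspace W,
    forall a b, W a -> W b -> W (a \o b) & forall a, W a -> W (adj a)]] G.

(* The bounded extension of D a - a D from dom D to the whole space; the
   condition includes that a preserves dom D. *)
Definition comm_ext (D : set (U * U)) (a : U -> U) : U -> U :=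
  xget (0 : U -> U) [set B : U -> U | [/\ linear B, continuous B &
    forall u w, D (u, w) -> D (a u, B u + a w)]].

End Operators.

(* A Hilbert space with a countable orthonormal basis, i.e. l^2 with its
   canonical basis up to a unique unitary; [ebasis i] is e_{i+1}: positive
   indices are shifted by one throughout. *)
Record ell2 (R : realType) := Ell2 {
  ell2_carrier :> hilbertType R;
  ebasis : nat -> ell2_carrier;
  ebasis_orthonormal : forall i j, inner (ebasis i) (ebasis j) = (i == j)%:R;
  ebasis_total : dense (lspan (range ebasis)) }.

(* The Hilbert tensor product, determined up to a unique unitary. *)
Record hilbert_tensor (R : realType) (U V : hilbertType R) := HilbertTensor {
  tensor_carrier :> hilbertType R;
  tensor : U -> V -> tensor_carrier;
  tensor_linearl : forall v, linear (tensor^~ v);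
  tensor_linearr : forall u, linear (tensor u);
  tensor_inner : forall u u' v v',
    inner (tensor u v) (tensor u' v') = inner u u' * inner v v';
  tensor_total : dense (lspan [set tensor u v | u in setT & v in setT]) }.

(* For n = 0 this is a line spanned by the unit vector [tpow u], u : 'I_0 -> U. *)
Record tensor_power (R : realType) (U : hilbertType R) (n : nat) := TensorPower {
  tpow_carrier :> hilbertType R;
  tpow : ('I_n -> U) -> tpow_carrier;
  tpow_linear : forall u i, linear (fun x => tpow [eta u with i |-> x]);
  tpow_inner : forall u u', inner (tpow u) (tpow u') = \prod_i inner (u i) (u' i);
  tpow_total : dense (lspan (range tpow)) }.

Section Symmetric.
Context {R : realType} {U : hilbertType R} {n : nat} {T : tensor_power U n}.

(* Invariance under the unitaries permuting the tensor factors, tested against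
   the total set of elementary tensors. *)
Definition symmetric_tensor (t : T) : Prop := forall (s : 'S_n) (u : 'I_n -> U),
  inner (tpow T (u \o s)) t = inner (tpow T u) t.

Definition sym_prod (u : 'I_n -> U) : T :=
  (n`!%:R)^-1 *: \sum_(s : 'S_n) tpow T (u \o s).

End Symmetric.

Definition fun_cat {T : Type} {m n : nat} (u : 'I_m -> T) (v : 'I_n -> T) :
    'I_(m + n) -> T :=
  fun i => match fintype.split i with inl j => u j | inr j => v j end.

Definition weight {R : realType} (tau p : R) (n : nat) : R :=
  expR (tau * n%:R `^ p).

(* The completion of the direct sum of the symmetric tensor powers, the n-th one
   with inner product scaled by w(n)^2, with its symmetric product. [fock_incl n]
   is only meaningful on symmetric tensors. *)
Record fock_space (R : realType) (w : nat -> R) (U : hilbertType R)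
    (T : forall n, tensor_power U n) := FockSpace {
  fock_carrier :> hilbertType R;
  fock_incl : forall n, T n -> fock_carrier;
  fock_incl_linear : forall n a (s t : T n),
    symmetric_tensor s -> symmetric_tensor t ->
    fock_incl (a *: s + t) = a *: fock_incl s + fock_incl t;
  fock_incl_inner : forall n (s t : T n),
    symmetric_tensor s -> symmetric_tensor t ->
    inner (fock_incl s) (fock_incl t) = ((w n) ^+ 2)%:C * inner s t;
  fock_incl_orthogonal : forall m n (s : T m) (t : T n), m != n ->
    symmetric_tensor s -> symmetric_tensor t ->
    inner (fock_incl s) (fock_incl t) = 0;
  fock_incl_total :
    dense (lspan [set x | exists n (t : T n),
                            symmetric_tensor t /\ x = fock_incl t]);
  vee : fock_carrier -> fock_carrier -> fock_carrier;
  vee_linear : forall x, linear (vee x);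
  veeC : forall x y, vee x y = vee y x;
  vee_unit : forall (u : 'I_0 -> U) x, vee (fock_incl (sym_prod u : T 0)) x = x;
  vee_bounded : exists C : R[i], forall x y, `|vee x y| <= C * `|x| * `|y|;
  vee_sym_prod : forall m n (u : 'I_m -> U) (v : 'I_n -> U),
    vee (fock_incl (sym_prod u : T m)) (fock_incl (sym_prod v : T n)) =
    fock_incl (sym_prod (fun_cat u v) : T (m + n)) }.

(* Elements of the space are identified with functions on X through [ev]. *)
Record rkhs (R : realType) (d : nat) (X : topologicalType)
    (M : smooth_manifold R d X) := Rkhs {
  rkhs_carrier :> hilbertType R;
  ev : rkhs_carrier -> X -> R[i];
  kersec : X -> rkhs_carrier;
  ev_linear : forall a f g x, ev (a *: f + g) x = a * ev f x + ev g x;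
  ev_inj : injective ev;
  ev_smooth : forall f, smooth_cfun M (ev f);
  reproducing : forall f x, ev f x = inner (kersec x) f;
  kernel_posdef : forall n (x : 'I_n -> X) (c : 'I_n -> R[i]), injective x ->
    (exists i, c i != 0) ->
    0 < \sum_i \sum_j (c i)^* * c j * ev (kersec (x i)) (x j) }.

Section Assumptions.
Context {R : realType} {d : nat} {X : topologicalType} {M : smooth_manifold R d X}.
Variables (v : vector_field M) (H : rkhs M) (Hinf : set H).

(* The unbounded operator V on H, with its maximal domain. *)
Definition Vop : set (H * H) := [set p | ev p.2 = der v (ev p.1)].

(* V for b = false, its adjoint for b = true. *)
Definition VV (b : bool) : H -> H := opapp (if b then adjoint Vop else Vop).

Definition word_norm (f : H) (n : nat) : R :=
  \sum_(eps : {ffun 'I_n -> bool})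
    complex.Re `|foldr (fun i => VV (eps i)) f (enum 'I_n)|.

Record generator_assumptions : Prop := GeneratorAssumptions {
  V_continuous :
    continuous ((fun f : H => der v (ev f)) : H -> {compact-open, X -> R[i]});
  Hinf_subspace : linear_subspace Hinf;
  Hinf_dense : dense Hinf;
  Hinf_dom : Hinf `<=` opdom Vop `&` opdom (adjoint Vop);
  Hinf_invariant : forall b f, Hinf f -> Hinf (VV b f);
  Hinf_analytic : forall f, Hinf f -> exists2 r : R, 0 < r &
    cvgn (pseries (fun n => (n`!%:R)^-1 * word_norm f n) r) }.

(* The generated subalgebra is not required to contain a unit: H need not
   contain the constants. *)
Definition subalgebra (G : set H) : set H :=
  smallest [set W : set H | linear_subspace W /\
    forall f g h, W f -> W g -> ev h = (fun x => ev f x * ev g x) -> W h] G.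

Record algebra_assumptions (HH : hilbert_tensor H H) (S0 : set H) : Prop := AlgebraAssumptions {
  rkha : exists Delta : H -> HH, [/\ linear Delta, continuous Delta &
    forall x, Delta (kersec H x) = tensor HH (kersec H x) (kersec H x)];
  S0_Hinf : S0 `<=` Hinf;
  S0_findim : exists s : seq H, S0 = lspan [set` s];
  S0_generates : dense (subalgebra S0) }.

Definition normalized_kernel : Prop := forall x, `|kersec H x| = 1.

Definition Aop (f : H) : H := 2^-1 *: (VV false f - VV true f).
Definition Sop (f : H) : H := 2^-1 *: (VV false f + VV true f).

Context {l2 : ell2 R} {K : hilbert_tensor l2 H}.

Definition matrix_unit (i j : nat) (u : l2) : l2 :=
  inner (ebasis l2 j) u *: ebasis l2 i.

Definition K0 : set K :=
  lspan [set tensor K (ebasis l2 j) f | j in setT & f in Hinf].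

(* The linear extension of its values on the e_j (x) f; the terms of index
   i > j in the defining series vanish on e_j (x) f. *)
Definition Lop : set (K * K) :=
  lspan [set p | exists j f, Hinf f /\
    p = (tensor K (ebasis l2 j) f,
         \sum_(i < j.+1)
           (tensor K (matrix_unit i i.+1 (ebasis l2 j)) (Sop f)
            + tensor K (matrix_unit i i (ebasis l2 j)) (Aop f)
            - tensor K (matrix_unit i.+1 i (ebasis l2 j)) (Sop f)))].

Fixpoint fib (n : nat) : nat :=
  match n with
  | 0 => 0
  | 1 => 1
  | (m.+1 as k).+1 => fib k + fib m
  end%N.

Definition Emb (n : nat) (f : H) : K :=
  \sum_(i < n) (fib i.+1)%:R *: tensor K (ebasis l2 i) f.

Context {w : nat -> R} {T : forall n, tensor_power K n}.
Variable F : fock_space w T.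

Definition fvee (n : nat) (u : 'I_n -> K) : F := fock_incl F (sym_prod u : T n).

(* n = 0 gives the value 0 at the unit. *)
Definition Dop : set (F * F) :=
  lspan [set p | exists n (u : 'I_n -> K), (forall i, K0 (u i)) /\
    p = (fvee u, \sum_i fvee [eta u with i |-> opapp Lop (u i)])].

Definition creation (u : K) : F -> F := vee (fvee (fun _ : 'I_1 => u)).
Definition annihilation (u : K) : F -> F := adj (creation u).

Definition alg_n (S0 : set H) (n : nat) : set (F -> F) :=
  star_alg ([set idfun] `|` [set annihilation (Emb n f) | f in S0]).

Definition Kx (x : X) (m : nat) : F :=
  limn (fun N => \sum_(m <= n < N)
    ((w n) ^- 2)%:C *: fvee (fun _ : 'I_n => tensor K (ebasis l2 0) (kersec H x))).

Definition phi (x : X) (m : nat) (a : F -> F) : R[i] :=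
  inner (Kx x m) (a (Kx x m)) / `|Kx x m| ^+ 2.

Definition Psi (x : X) (a : F -> F) : R[i] := limn (fun m => phi x m a).

Definition Psihat (a : F -> F) : X -> R[i] := fun x => Psi x a.

End Assumptions.

Arguments Dop {R d X M} v [H] Hinf {l2 K w T} F _.
Arguments alg_n {R d X M} [H] {l2 K w T} F S0 n _.
Arguments Psihat {R d X M} [H] {l2 K w T} F a _.

(* Main.v *)
Require Import Defs.
From HB Require Import structures.
From mathcomp Require Import all_boot all_order all_algebra perm.
From mathcomp Require Import all_classical all_reals all_analysis.
From mathcomp Require Import complex ring lra.

(** The coherent vectors K^m = sum_(n >= m) w(n)^-2 xi^n, with xi = e_1 (x) k_x a
    unit vector, are asymptotically joint eigenvectors of all creation and
    annihilation operators: a_u K^m is exactly a multiple of K^(m-1), and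
    |u v K^m - <xi, u> K^m| / |K^m| tends to 0 because w(n+1) / w(n) tends to 1.
    Hence Psi_x is multiplicative on the algebra generated by the a_u, with
    Psi_x(a_u) = conj <xi, u>.  Since L is skew, [D, a_u] = a_(L u), so both sides
    of the identity are derivations in a and it suffices to compare them on
    u = E_n f: there <xi, E_n f> = f(x), and the first two Fibonacci numbers being
    1 gives <xi, L E_n f> = (A f)(x) + (S f)(x) = (V f)(x). *)

Set Implicit Arguments.
Unset Strict Implicit.
Unset Printing Implicit Defensive.

Import Order.TTheory GRing.Theory Num.Theory numFieldNormedType.Exports.

(** [adj], [opapp] and [comm_ext] choose a witness by [xget], so they carry information only once a
    witness is known to exist and to be unique. Existence of the annihilation operators comes from
    their explicit value on symmetric products, combined with closedness of the domain of an
    adjoint; uniqueness of the commutator comes from [Dop] being skew with dense domain.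

    The commutator of an element of [alg_n] need not lie in [alg_n], since L E_n g need not be of
    the form E_n h. The induction over the generated algebra therefore runs on a predicate bundling
    an operator, its adjoint and both commutators with their limit values.

    For creation operators no exact eigenvector relation is available and a norm has to be computed:
    in the square norm of u v xi^n, symmetrisation leaves the part of u orthogonal to xi a share
    1/(n+1), so only <xi, u> survives in the limit. The ratio w(n+1) / w(n) enters twice, there and
    in showing that a single term of the coherent series is negligible against the tail after it.
    The bound 2 <= n lets E_n f reach the entry S in the row of e_1 of L; from e_1 alone only A f
    would appear. *)

(** * Real-valued norms on complex normed spaces *)

Section RealNorm.
Context {R : realType}.

(* The norm of the library takes values in R[i], whose order is only partial. *)
Definition rn {V : normedModType R[i]} (x : V) : R := complex.Re `|x|.

Context {V : normedModType R[i]}.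
Implicit Types x y : V.

Lemma normE_rn x : `|x| = (rn x)%:C.
Proof. by rewrite /rn RRe_real ?normr_real. Qed.

Lemma rn_ge0 x : 0 <= rn x.
Proof. by rewrite -ler0c -normE_rn. Qed.

Lemma rn0 : rn (0 : V) = 0.
Proof. by rewrite /rn normr0. Qed.

Lemma rn_eq0 x : rn x = 0 -> x = 0.
Proof. by move=> x0; apply/normr0_eq0; rewrite normE_rn x0. Qed.

Lemma rnN x : rn (- x) = rn x.
Proof. by rewrite /rn normrN. Qed.

Lemma rnB x y : rn (x - y) = rn (y - x).
Proof. by rewrite /rn distrC. Qed.

Lemma rnD x y : rn (x + y) <= rn x + rn y.
Proof. by rewrite -lecR rmorphD /= -!normE_rn ler_normD. Qed.

Lemma rn_triangle x y z : rn (x - z) <= rn (x - y) + rn (y - z).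
Proof. by apply: le_trans (rnD _ _); rewrite subrKA. Qed.

Lemma ball_rn x (e : R) y : ball x e%:C y = (rn (x - y) < e) :> Prop.
Proof. by rewrite -ball_normE /ball_ /= normE_rn ltcR. Qed.

End RealNorm.

Section RealNormScalar.
Context {R : realType}.

Lemma rnZ (V : normedModType R[i]) (a : R[i]) (x : V) : rn (a *: x) = rn a * rn x.
Proof. by apply: complexI; rewrite rmorphM /= -!normE_rn normrZ. Qed.

Lemma rnC (a : R) : rn (a%:C : R[i]) = `|a|.
Proof. by rewrite /rn normc_def /= expr0n addr0 sqrtr_sqr. Qed.

Lemma rnM (a b : R[i]) : rn (a * b) = rn a * rn b.
Proof. by apply: complexI; rewrite rmorphM /= -!normE_rn normrM. Qed.

Lemma conjcM (a b : R[i]) : (a * b)^*%C = a^*%C * b^*%C.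
Proof. exact: rmorphM. Qed.

Lemma rn_conj (a : R[i]) : rn (a^*%C) = rn a.
Proof. by rewrite /rn normcJ. Qed.

Lemma rn_sqr (a : R[i]) : ((rn a) ^+ 2)%:C = a^*%C * a.
Proof. by rewrite rmorphXn /= -normE_rn sqr_normc mulrC. Qed.

Lemma Re_le_rn (a : R[i]) : complex.Re a <= rn a.
Proof.
by apply: le_trans (ler_norm _) _; rewrite -lecR -normE_rn; exact: normc_ge_Re.
Qed.

End RealNormScalar.

(** * Inner product calculus *)

Section InnerProduct.
Context {R : realType} {U : hilbertType R}.
Implicit Types u v x y : U.

Lemma innerDr u x y : inner u (x + y) = inner u x + inner u y.
Proof. by rewrite -{1}[x]scale1r inner_linear mul1r. Qed.

Lemma inner0r u : inner u 0 = 0.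
Proof. by apply: (addrI (inner u 0)); rewrite -innerDr !addr0. Qed.

Lemma innerZr a u x : inner u (a *: x) = a * inner u x.
Proof. by rewrite -[a *: x]addr0 inner_linear inner0r addr0. Qed.

Lemma innerNr u x : inner u (- x) = - inner u x.
Proof. by rewrite -scaleN1r innerZr mulN1r. Qed.

Lemma innerBr u x y : inner u (x - y) = inner u x - inner u y.
Proof. by rewrite innerDr innerNr. Qed.

Lemma innerC u v : inner v u = (inner u v)^*%C.
Proof. exact: inner_conj. Qed.

Lemma innerDl x y u : inner (x + y) u = inner x u + inner y u.
Proof. by rewrite innerC innerDr rmorphD /= -!innerC. Qed.

Lemma innerZl a x u : inner (a *: x) u = a^*%C * inner x u.
Proof. by rewrite innerC innerZr rmorphM /= -!innerC. Qed.

Lemma inner0l u : inner 0 u = 0.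
Proof. by rewrite innerC inner0r conjc0. Qed.

Lemma innerNl u x : inner (- x) u = - inner x u.
Proof. by rewrite innerC innerNr rmorphN /= -innerC. Qed.

Lemma innerBl x y u : inner (x - y) u = inner x u - inner y u.
Proof. by rewrite innerDl innerNl. Qed.

Lemma inner_sumr (I : Type) (r : seq I) (P : pred I) (f : I -> U) u :
  inner u (\sum_(i <- r | P i) f i) = \sum_(i <- r | P i) inner u (f i).
Proof.
by apply: (big_morph (inner u)) => [x y|]; rewrite ?innerDr ?inner0r.
Qed.

Lemma inner_suml (I : Type) (r : seq I) (P : pred I) (f : I -> U) u :
  inner (\sum_(i <- r | P i) f i) u = \sum_(i <- r | P i) inner (f i) u.
Proof.
by apply: (big_morph (inner^~ u)) => [x y|]; rewrite ?innerDl ?inner0l.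
Qed.

Lemma inner_rn u : inner u u = ((rn u) ^+ 2)%:C.
Proof. by rewrite inner_norm normE_rn rmorphXn. Qed.

Lemma rn_sqrE u : (rn u) ^+ 2 = complex.Re (inner u u).
Proof. by rewrite inner_rn. Qed.

(** The vector |v|^2 u - <v, u> v is |v|^2 times the part of u orthogonal to v; its square norm is
    nonnegative. *)
Lemma inner_cauchy_schwarz u v : rn (inner u v) <= rn u * rn v.
Proof.
have [v0|v0] := eqVneq (rn v) 0.
  by rewrite (rn_eq0 v0) inner0r !rn0 mulr0.
have vp : 0 < rn v by rewrite lt0r v0 rn_ge0.
set c := inner v u; set n2 := (rn v) ^+ 2.
have n2p : 0 < n2 by rewrite exprn_gt0.
have H : (n2 * (n2 * (rn u) ^+ 2 - (rn c) ^+ 2))%:C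
    = inner (n2%:C *: u - c *: v) (n2%:C *: u - c *: v).
  rewrite !(innerBl, innerBr, innerZl, innerZr) !inner_rn -/n2 -/c.
  rewrite (innerC v u) -/c conjc_real.
  have -> : (n2 * (n2 * rn u ^+ 2 - rn c ^+ 2))%:C =
      n2%:C * (n2%:C * (rn u ^+ 2)%:C - (rn c ^+ 2)%:C).
    by rewrite -rmorphM -rmorphB -rmorphM.
  by rewrite rn_sqr; ring.
have : 0 <= n2 * (n2 * (rn u) ^+ 2 - (rn c) ^+ 2).
  by rewrite -ler0c H inner_rn ler0c sqr_ge0.
rewrite pmulr_rge0// subr_ge0 /n2 -exprMn mulrC => h.
have := h; rewrite ler_sqr ?nnegrE ?mulr_ge0 ?rn_ge0// => {}h.
by rewrite innerC rn_conj.
Qed.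

Lemma inner_extl x y : (forall z, inner x z = inner y z) -> x = y.
Proof.
move=> h; apply/subr0_eq/rn_eq0/eqP; rewrite -sqrf_eq0; apply/eqP.
by rewrite rn_sqrE innerBl h subrr.
Qed.

Lemma rn_subr_sqr x y :
  rn (x - y) ^+ 2 = rn x ^+ 2 - 2 * complex.Re (inner x y) + rn y ^+ 2.
Proof.
rewrite !rn_sqrE !(innerBl, innerBr) (innerC x y).
by case: (inner x x) (inner y y) (inner x y) => [a b] [e f] [g h] /=; ring.
Qed.

End InnerProduct.

(** * Linear spans and bounded linear maps *)

Section LinearSpan.
Context {R : realType} {V : lmodType R[i]}.
Implicit Types (G W : set V).

Lemma subspaceD W x y : linear_subspace W -> W x -> W y -> W (x + y).
Proof. by move=> [_ h] wx wy; rewrite -[x]scale1r; exact: h. Qed.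

Lemma subspaceZ W a x : linear_subspace W -> W x -> W (a *: x).
Proof. by move=> [w0 h] wx; rewrite -[_ *: _]addr0; exact: h. Qed.

Lemma subspaceB W x y : linear_subspace W -> W x -> W y -> W (x - y).
Proof.
move=> Ws wx wy; rewrite -scaleN1r; apply: subspaceD => //.
exact: subspaceZ.
Qed.

Lemma subspace_sum W (I : Type) (r : seq I) (P : pred I) (f : I -> V) :
  linear_subspace W -> (forall i, P i -> W (f i)) -> W (\sum_(i <- r | P i) f i).
Proof.
move=> Ws h; apply: (big_ind W) => //; first by case: Ws.
by move=> x y; exact: subspaceD.
Qed.

Lemma lspan_subspace G : linear_subspace (lspan G).
Proof.
split; first by move=> W [[]].
by move=> a u v hu hv W [Ws GW]; apply: Ws.2; [exact: hu | exact: hv].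
Qed.

Lemma lspan_gen G x : G x -> lspan G x.
Proof. by move=> Gx W [_]; exact. Qed.

Lemma lspan_min G W : linear_subspace W -> G `<=` W -> lspan G `<=` W.
Proof. by move=> Ws GW x; apply. Qed.

End LinearSpan.

Section BoundedLinear.
Context {R : realType} {V W : normedModType R[i]}.

Definition bounded_linear (a : V -> W) :=
  linear a /\ exists2 C : R, 0 <= C & forall x, rn (a x) <= C * rn x.

Implicit Types a b : V -> W.

Lemma linD a x y : linear a -> a (x + y) = a x + a y.
Proof. by move=> h; rewrite -{1}[x]scale1r h scale1r. Qed.

Lemma lin0 a : linear a -> a 0 = 0.
Proof. by move=> h; apply: (addrI (a 0)); rewrite -linD // !addr0. Qed.

Lemma linZ a c x : linear a -> a (c *: x) = c *: a x.
Proof. by move=> h; rewrite -[c *: x]addr0 h (lin0 h) addr0. Qed.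

Lemma linB a x y : linear a -> a (x - y) = a x - a y.
Proof. by move=> h; rewrite -scaleN1r linD // linZ // scaleN1r. Qed.

Lemma lin_sum a (I : Type) (r : seq I) (P : pred I) (f : I -> V) :
  linear a -> a (\sum_(i <- r | P i) f i) = \sum_(i <- r | P i) a (f i).
Proof.
by move=> h; apply: (big_morph a) => [x y|]; [exact: linD | exact: lin0].
Qed.

Lemma bounded_linear_lin c a b : bounded_linear a -> bounded_linear b ->
  bounded_linear (c *: a + b).
Proof.
move=> [la [C C0 ha]] [lb [D D0 hb]]; split.
  move=> k x y; rewrite !fctE /= la lb !scalerDr !scalerA [c * k]mulrC.
  by rewrite -!addrA; congr (_ + _); rewrite addrCA.
exists (rn c * C + D); first by rewrite addr_ge0 ?mulr_ge0 ?rn_ge0.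
move=> x; rewrite mulrDl; apply: le_trans (rnD _ _) _.
by rewrite lerD // rnZ -mulrA ler_wpM2l ?rn_ge0.
Qed.

Lemma bounded_linear0 : bounded_linear (0 : V -> W).
Proof.
have e (z : V) : (0 : V -> W) z = 0 by [].
split; first by move=> k x y; rewrite !e scaler0 addr0.
by exists 0 => // x; rewrite e rn0 mul0r.
Qed.

(** Bridge between [comm_ext], which asks for continuity, and the estimates below, which use a real
    constant: the bound obtained from continuity is a nonnegative element of [R[i]], whose real part
    is taken. *)
Lemma bounded_linearP a : linear a -> continuous a <-> bounded_linear a.
Proof.
move=> la.
pose m : {linear V -> W} := HB.pack a (GRing.isLinear.Build _ _ _ _ a la).
split=> [ca|[_ [C C0 hC]]].
  have /linear_boundedP [r [rr hr]] : bounded_near m (nbhs 0).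
    by apply: continuous_linear_bounded; exact: ca.
  have [k k0 h] : exists2 k : R[i], 0 <= k & forall x, `|a x| <= k * `|x|.
    exists (`|r| + 1) => [|x]; first exact: addr_ge0.
    by apply: hr; rewrite (le_lt_trans (real_ler_norm rr)) // ltrDl.
  have kr := ger0_real k0.
  split=> //; exists (complex.Re k) => [|x]; first by rewrite -ler0c RRe_real.
  by rewrite -lecR rmorphM /= -!normE_rn RRe_real; first exact: h.
apply: (@bounded_linear_continuous _ _ _ m); apply/linear_boundedP.
exists C%:C; split; first by rewrite complex_real.
move=> r Cr x; apply: le_trans (_ : C%:C * `|x| <= _).
  by rewrite !normE_rn -rmorphM lecR; exact: hC.
by rewrite ler_wpM2r // ltW.
Qed.

End BoundedLinear.

Lemma bounded_linear_comp (R : realType) (U V W : normedModType R[i])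
    (a : V -> W) (b : U -> V) :
  bounded_linear a -> bounded_linear b -> bounded_linear (a \o b).
Proof.
move=> [la [C C0 ha]] [lb [D D0 hb]]; split=> [k x y|]; first by rewrite /= lb la.
exists (C * D) => [|x]; first exact: mulr_ge0.
by apply: le_trans (ha _) _; rewrite -mulrA ler_wpM2l.
Qed.

Lemma bounded_linear_id (R : realType) (V : normedModType R[i]) :
  bounded_linear (@idfun V).
Proof. by split=> //; exists 1 => // x; rewrite mul1r. Qed.

Lemma cvg0M (R : realType) (f : nat -> R) c :
  f @ \oo --> (0 : R) -> (fun n => f n * c) @ \oo --> (0 : R).
Proof. by move=> f0; rewrite -(mul0r c); apply: cvgM => //; exact: cvg_cst. Qed.

Lemma cvg0D (R : realType) (f g : nat -> R) :
  f @ \oo --> (0 : R) -> g @ \oo --> (0 : R) ->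
  (fun n => f n + g n) @ \oo --> (0 : R).
Proof. by move=> f0 g0; rewrite -(addr0 0); exact: cvgD. Qed.

Lemma cvg0_squeeze (R : realType) (f g : nat -> R) :
  g @ \oo --> (0 : R) -> (forall n, 0 <= f n <= g n) -> f @ \oo --> (0 : R).
Proof.
move=> g0 fg; apply: (squeeze_cvgr _ (cvg_cst 0) g0); exact: nearW.
Qed.

(** * Closures and density *)

Section Closure.
Context {R : realType} {V : normedModType R[i]}.
Implicit Types S W : set V.

(** Closure in terms of real radii, the balls of the library having their radii in [R[i]]. *)
Definition cl S : set V :=
  [set x | forall e : R, 0 < e -> exists2 y, S y & rn (x - y) < e].

Lemma sub_cl S : S `<=` cl S.
Proof. by move=> x Sx e e0; exists x => //; rewrite subrr rn0. Qed.

Lemma dense_cl S : dense S <-> forall x, cl S x.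
Proof.
split=> [dS x e e0|h].
  have e0' : 0 < e%:C :> R[i] by rewrite ltcR.
  have [] := dS _ _ (@open_interior _ (ball x e%:C)).
    by exists x; apply: nbhsx_ballx.
  move=> y [/interior_subset]; rewrite ball_rn => yx Sy.
  by exists y.
move=> O [x Ox] oO.
have /nbhs_ballP [e /= e0 xO] : nbhs x O by exact: open_nbhs_nbhs.
have er : e = (complex.Re e)%:C by rewrite RRe_real // gtr0_real.
have [|y Sy yx] := h x (complex.Re e); first by rewrite -ltcR -er.
by exists y; split=> //; apply: xO; rewrite er ball_rn.
Qed.

Lemma cl_idem S : cl (cl S) `<=` cl S.
Proof.
move=> x h e e0; have e2 : 0 < e / 2 by rewrite divr_gt0.
have [y hy xy] := h _ e2; have [z Sz yz] := hy _ e2; exists z => //.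
by apply: le_lt_trans (rn_triangle x y z) _; rewrite [e]splitr ltrD.
Qed.

Lemma cl_mono S S' : S `<=` S' -> cl S `<=` cl S'.
Proof. by move=> SS x h e e0; have [y /SS Sy xy] := h e e0; exists y. Qed.

Lemma bounded_linear_cl (W : normedModType R[i]) (a : V -> W) S x (S' : set W) :
  bounded_linear a -> cl S x -> a @` S `<=` S' ->
  forall e : R, 0 < e -> exists2 y, S' y & rn (a x - y) < e.
Proof.
move=> [la [C C0 h]] Sx SS e e0.
have C1 : 0 < C + 1 by rewrite ltr_wpDl.
have [y Sy xy] := Sx (e / (C + 1)) (divr_gt0 e0 C1).
exists (a y); first by apply: SS; exists y.
rewrite -linB //; apply: le_lt_trans (h _) _.
move: xy; rewrite ltr_pdivlMr // => xy.
by apply: le_lt_trans xy; rewrite mulrC ler_wpM2l ?rn_ge0 // lerDl.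
Qed.

Lemma cl_subspace S : linear_subspace S -> linear_subspace (cl S).
Proof.
move=> Ss; split; first by apply: sub_cl; case: Ss.
move=> a u v hu hv e e0; have e2 : 0 < e / 2 by rewrite divr_gt0.
have k0 : 0 < rn a + 1 by rewrite ltr_wpDl // rn_ge0.
have [y Sy uy] := hu _ (divr_gt0 e2 k0); have [z Sz vz] := hv _ e2.
exists (a *: y + z); first by case: Ss => _; apply.
rewrite opprD addrACA -scalerBr; apply: le_lt_trans (rnD _ _) _.
rewrite [e]splitr ltrD // rnZ; move: uy; rewrite ltr_pdivlMr // => uy.
by apply: le_lt_trans uy; rewrite mulrC ler_wpM2l ?rn_ge0 // lerDl.
Qed.

Lemma bounded_linear_dense_eq (W : normedModType R[i]) (a b : V -> W) S :
  bounded_linear a -> bounded_linear b -> (forall x, cl S x) ->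
  (forall x, S x -> a x = b x) -> a = b.
Proof.
move=> ha hb dS h; apply/funext => x; apply/subr0_eq/rn_eq0/eqP.
have hd := bounded_linear_lin (-1) hb ha.
rewrite eq_le rn_ge0 andbT; apply/ler_addgt0Pr => e e0; rewrite add0r.
have [|y -> /ltW] := bounded_linear_cl (S' := [set 0]) hd (dS x) _ e0.
  by move=> _ [z Sz <-] /=; rewrite !fctE h // scaleN1r addNr.
by rewrite !fctE subr0 scaleN1r addrC.
Qed.

End Closure.

(** * Existence and uniqueness of adjoints *)

Section AdjointPair.
Context {R : realType} {U : hilbertType R}.
Implicit Types (a b : U -> U) (S : set U).

Lemma bounded_linear_inner z : bounded_linear (inner z : U -> R[i]).
Proof.
split; first by move=> k x y; exact: inner_linear.
by exists (rn z); [exact: rn_ge0 | move=> x; exact: inner_cauchy_schwarz].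
Qed.

Lemma inner_dense_eq S x y : (forall z, cl S z) ->
  (forall z, S z -> inner x z = inner y z) -> x = y.
Proof.
move=> dS h; apply: inner_extl => z.
have e := bounded_linear_dense_eq (bounded_linear_inner x)
  (bounded_linear_inner y) dS h.
by rewrite e.
Qed.

(** Identities between vectors of the Fock space are later proved by testing against symmetric
    products in this way. *)
Lemma inner_lspan_eq (G : set U) x y : (forall z, cl (lspan G) z) ->
  (forall z, G z -> inner x z = inner y z) -> x = y.
Proof.
move=> dG h; apply: inner_dense_eq dG _ => z; move: z; apply: lspan_min => //.
split=> [|a u v /= hu hv]; first by rewrite /= !inner0r.
by rewrite !inner_linear hu hv.
Qed.

(** A relation, because the chosen function [adj a] is meaningful only after a partner of [a] has
    been exhibited. *)
Definition adjpair a b := forall x y, inner x (a y) = inner (b x) y.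

Lemma adjpair_sym a b : adjpair a b -> adjpair b a.
Proof. by move=> h x y; rewrite innerC -h -innerC. Qed.

Lemma adjpair_adj a b : adjpair a b -> adj a = b.
Proof.
move=> h; apply/funext => u.
rewrite /adj /opapp; apply: xget_unique => /=.
  by move=> f g [z _ [<- <-]] /=; rewrite h.
move=> w hw; apply: inner_extl => z; rewrite -h.
by rewrite (hw z (a z)) //; exists z.
Qed.

Lemma cvg_rn (V : normedModType R[i]) (z : nat -> V) (l : V) :
  z @ \oo --> l <-> (fun n => rn (l - z n)) @ \oo --> (0 : R).
Proof.
split=> /cvgrPdist_lt h; apply/cvgrPdist_lt => e e0.
  have e0' : 0 < e%:C :> R[i] by rewrite ltcR.
  near=> n; rewrite sub0r normrN ger0_norm ?rn_ge0 // -ltcR -normE_rn.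
  by near: n; exact: h.
have er : e = (complex.Re e)%:C by rewrite RRe_real // gtr0_real.
have e0' : 0 < complex.Re e by rewrite -ltcR -er.
near=> n; rewrite er normE_rn ltcR.
have : `|0 - rn (l - z n)| < complex.Re e by near: n; exact: h.
by rewrite sub0r normrN ger0_norm ?rn_ge0.
Unshelve. all: by end_near. Qed.

Lemma cauchy_rn_cvg (V : completeNormedModType R[i]) (z : nat -> V) (c : nat -> R) :
  c @ \oo --> (0 : R) ->
  (forall m n, (m <= n)%N -> rn (z m - z n) <= c m) -> cvgn z.
Proof.
move=> c0 h; apply/cauchy_cvgP/cauchyP => e e0.
have er : e = (complex.Re e)%:C by rewrite RRe_real // gtr0_real.
have e0' : 0 < complex.Re e by rewrite -ltcR -er.
have /cvgrPdist_lt/(_ _ e0') [N _ hN] := c0.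
exists (z N), N => // n /= Nn; rewrite er ball_rn.
apply: le_lt_trans (h _ _ Nn) _.
by have := hN N (leqnn N); rewrite /= sub0r normrN; exact/le_lt_trans/ler_norm.
Qed.

(* The domain of the adjoint of a bounded operator is closed, hence everything
   as soon as it is dense. *)
Lemma adjpair_exists a S : bounded_linear a -> (forall x, cl S x) ->
  (forall x, S x -> exists z, forall f, inner x (a f) = inner z f) ->
  exists2 b, bounded_linear b & adjpair a b.
Proof.
move=> [la [C C0 hC]] dS hS.
pose P x z := forall f, inner x (a f) = inner z f.
(* Since <z, z> = <x, a z>, a partner inherits the constant of [a]; hence partners of a Cauchy
   sequence form a Cauchy sequence. *)
have Pb x z : P x z -> rn z <= C * rn x.
  move=> xz; have [->|z0] := eqVneq (rn z) 0.
    by rewrite mulr_ge0 // rn_ge0.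
  have zp : 0 < rn z by rewrite lt0r z0 rn_ge0.
  rewrite -(ler_pM2r zp) -expr2 rn_sqrE -xz.
  apply: le_trans (Re_le_rn _) _; apply: le_trans (inner_cauchy_schwarz _ _) _.
  by rewrite mulrAC mulrC ler_wpM2r ?rn_ge0.
have PB k x z x' z' : P x z -> P x' z' -> P (k *: x + x') (k *: z + z').
  by move=> xz xz' f; rewrite !innerDl !innerZl xz xz'.
have tot x : exists z, P x z.
  have e0 n : 0 < harmonic n :> R by rewrite invr_gt0 ltr0n.
  have /choice [y hy] : forall n, exists y, S y /\ rn (x - y) < harmonic n.
    by move=> n; have [y] := dS x _ (e0 n); exists y.
  have /choice [z hz] : forall n, exists z, P (y n) z.
    by move=> n; have [/hS] := hy n.
  have cz : cvgn z.
    (* For m <= n both [y m] and [y n] lie within [harmonic m] of [x], whence the factor 2. *)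
    apply: (@cauchy_rn_cvg _ z (fun n => C * (2 * harmonic n))).
      by rewrite -(mulr0 C);
        apply: cvgZr; rewrite -(mulr0 2); apply: cvgZr; exact: cvg_harmonic.
    move=> m n mn; have := PB (-1) _ _ _ _ (hz n) (hz m).
    rewrite !scaleN1r ![- _ + _]addrC => /Pb /le_trans -> //.
    rewrite ler_wpM2l //; apply: le_trans (rn_triangle _ x _) _.
    rewrite mulr_natl mulr2n lerD //; first by rewrite rnB ltW ?(hy m).2.
    apply: le_trans (ltW (hy n).2) _.
    by rewrite lef_pV2 ?posrE ?ltr0n // ler_nat ltnS.
  exists (limn z) => f; apply/subr0_eq/rn_eq0/eqP.
  rewrite eq_le rn_ge0 andbT.
  have /cvg_rn zl : z @ \oo --> limn z by exact: cz.
  have zl' : (fun n => harmonic n * rn (a f) + rn (limn z - z n) * rn f) @ \oo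
      --> (0 : R).
    by apply: cvg0D; apply: cvg0M => //; exact: cvg_harmonic.
  rewrite -(cvg_lim (@Rhausdorff _) zl'); apply: limr_ge; first by apply/cvg_ex; exists 0.
  apply: nearW => n.
  have -> : inner x (a f) - inner (limn z) f =
      inner (x - y n) (a f) + inner (z n - limn z) f.
    by rewrite !innerBl (hz n f); ring.
  apply: le_trans (rnD _ _) _; apply: lerD.
    apply: le_trans (inner_cauchy_schwarz _ _) _.
    by rewrite ler_wpM2r ?rn_ge0 // ltW // (hy n).2.
  by rewrite [rn (limn z - _)]rnB; exact: inner_cauchy_schwarz.
have [b hb] := choice tot; exists b => [|x f]; last exact: hb.
split; last by exists C => // x; exact: Pb.
by move=> k x y; apply: inner_extl => f; rewrite -(hb (k *: x + y)); exact: PB.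
Qed.

End AdjointPair.

(** * Skew graphs and bounded commutators *)

Section SkewGraph.
Context {R : realType} {U : hilbertType R} (D : set (U * U)).
Hypothesis D_skew : forall p q, D p -> D q -> inner p.1 q.2 = - inner p.2 q.1.
Hypothesis D_dense : forall x, cl (opdom D) x.

(** By skewness, two values at [u] have the same inner products with the dense domain. *)
Lemma skew_functional u w w' : D (u, w) -> D (u, w') -> w = w'.
Proof.
move=> h h'; apply: inner_dense_eq D_dense _ => z [t zt]; apply: oppr_inj.
by rewrite -(D_skew h zt) -(D_skew h' zt).
Qed.

Lemma opapp_skew u w : D (u, w) -> opapp D u = w.
Proof.
by move=> h; apply: xget_unique => // w' h'; exact: skew_functional h' h.
Qed.

Lemma opappP u : opdom D u -> D (u, opapp D u).
Proof. by move=> [w uw]; rewrite (opapp_skew uw). Qed.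

Definition commutator_on (a B : U -> U) :=
  forall u w, D (u, w) -> D (a u, B u + a w).

(** Two candidates agree on the domain of [D] because [D] is single-valued, and everywhere because
    that domain is dense. *)
Lemma comm_extE a B : bounded_linear B -> commutator_on a B -> comm_ext D a = B.
Proof.
move=> hB aB; apply: xget_unique => /=.
  by split=> //; [case: hB | apply/bounded_linearP => //; case: hB].
move=> B' [lB' cB' aB']; apply: (bounded_linear_dense_eq _ hB D_dense).
  exact/bounded_linearP.
by move=> u [w uw]; apply: (addIr (a w)); apply: skew_functional (aB' _ _ uw) (aB _ _ uw).
Qed.

End SkewGraph.

(** * Permanents and symmetric tensors *)

(** Laplace expansion of a permanent along its first row: the permutations sending 0 to j are
    exactly the [lift_perm ord0 j t], and [ulsf] recovers t by deleting 0 and its image. *)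
Lemma permanent_expand (A : comPzRingType) n (M : 'I_n.+1 -> 'I_n.+1 -> A) :
  \sum_(s : 'S_n.+1) \prod_i M i (s i) =
  \sum_j M ord0 j * \sum_(s : 'S_n) \prod_i M (lift ord0 i) (lift j (s i)).
Proof.
rewrite (partition_big (fun s : 'S_n.+1 => s ord0) xpredT) //=.
apply: eq_bigr => j _; rewrite big_distrr /=.
rewrite (reindex (lift_perm ord0 j)); last first.
  pose ulsf i (s : 'S_n.+1) k := odflt k (unlift (s i) (s (lift i k))).
  have ulsfK i (s : 'S_n.+1) k: lift (s i) (ulsf i s k) = s (lift i k).
    rewrite /ulsf; have:= neq_lift i k.
    by rewrite -(can_eq (permK s)) => /unlift_some[] ? ? ->.
  have inj_ulsf: injective (ulsf ord0 _).
    move=> s; apply: can_inj (ulsf (s ord0) s^-1%g) _ => k'.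
    by rewrite {1}/ulsf ulsfK !permK liftK.
  exists (fun s => perm (inj_ulsf s)) => [s _ | s].
    by apply/permP=> k'; rewrite permE /ulsf lift_perm_lift lift_perm_id liftK.
  move/(s _ =P _) => si0; apply/permP=> k.
  case: (unliftP ord0 k) => [k'|] ->; rewrite ?lift_perm_id //.
  by rewrite lift_perm_lift -si0 permE ulsfK.
rewrite (eq_bigl xpredT) => [|s]; last by rewrite lift_perm_id eqxx.
apply: eq_bigr => s _; rewrite big_ord_recl lift_perm_id; congr (_ * _).
by apply: eq_bigr => i _; rewrite lift_perm_lift.
Qed.

Section SymmetricTensors.
Context {R : realType} {U : hilbertType R} {n : nat} {T : tensor_power U n}.
Implicit Types (u v : 'I_n -> U) (s t : T).

Lemma inner_tpow_sym_prod u v :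
  inner (tpow T u) (sym_prod v : T) =
  (n`!%:R)^-1 * \sum_(s : 'S_n) \prod_i inner (u i) (v (s i)).
Proof.
rewrite innerZr inner_sumr; congr (_ * _).
by apply: eq_bigr => s _; rewrite tpow_inner.
Qed.

Lemma sym_prod_symmetric u : symmetric_tensor (sym_prod u : T).
Proof.
move=> s v; rewrite !inner_tpow_sym_prod; congr (_ * _).
rewrite (reindex_inj (mulgI s)) /=; apply: eq_bigr => t _.
rewrite [RHS](reindex_inj (@perm_inj _ s)) /=.
by apply: eq_bigr => i _; rewrite permM.
Qed.

(** [sym_prod u] is the orthogonal projection of the elementary tensor on the symmetric ones, so a
    symmetric [t] does not see the averaging. *)
Lemma inner_sym_prodl u t : symmetric_tensor t ->
  inner (sym_prod u) t = inner (tpow T u) t.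
Proof.
move=> st; rewrite innerZl inner_suml conjc_inv conjc_nat.
under eq_bigr do rewrite st.
rewrite sumr_const card_Sn -[inner _ _ *+ _]mulr_natl mulrA.
by rewrite mulVf ?mul1r ?pnatr_eq0 -?lt0n ?fact_gt0 //.
Qed.

Lemma inner_sym_prod u v :
  inner (sym_prod u : T) (sym_prod v) =
  (n`!%:R)^-1 * \sum_(s : 'S_n) \prod_i inner (u i) (v (s i)).
Proof.
by rewrite inner_sym_prodl ?inner_tpow_sym_prod //; exact: sym_prod_symmetric.
Qed.

Lemma symmetric_subspace : linear_subspace (@symmetric_tensor _ _ _ T).
Proof.
split=> [s u|a s t hs ht p u]; first by rewrite !inner0r.
by rewrite !inner_linear hs ht.
Qed.

Lemma upd_perm u (i : 'I_n) x (s : 'S_n) :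
  [eta u with i |-> x] \o s = [eta (u \o s) with (s^-1)%g i |-> x].
Proof.
by apply/funext => j; rewrite /= -(inj_eq (@perm_inj _ s)) permKV.
Qed.

Lemma sym_prod_linear u (i : 'I_n) :
  linear (fun x => sym_prod [eta u with i |-> x] : T).
Proof.
move=> a x y; rewrite /sym_prod scalerA mulrC -scalerA -scalerDr (scaler_sumr a).
rewrite -big_split /=; congr (_ *: _); apply: eq_bigr => s _.
by rewrite !upd_perm tpow_linear.
Qed.

Lemma rn_tpow_sqr u : rn (tpow T u) ^+ 2 = \prod_i rn (u i) ^+ 2.
Proof.
apply: complexI; rewrite -inner_rn tpow_inner rmorph_prod /=.
by apply: eq_bigr => i _; rewrite inner_rn.
Qed.

Lemma rn_tpow u : rn (tpow T u) = \prod_i rn (u i).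
Proof.
apply/eqP; rewrite -(@eqrXn2 _ 2) ?rn_ge0 ?prodr_ge0 // => [|i _].
  by rewrite rn_tpow_sqr prodrXl.
exact: rn_ge0.
Qed.

(* Orthogonal projections are contractions: [t] is the projection of [s]. *)
Lemma rn_le_of_inner s t : inner t t = inner s t -> rn t <= rn s.
Proof.
move=> h; have [->|t0] := eqVneq (rn t) 0; first exact: rn_ge0.
have tp : 0 < rn t by rewrite lt0r t0 rn_ge0.
rewrite -(ler_pM2r tp) -expr2 rn_sqrE h.
exact: le_trans (Re_le_rn _) (inner_cauchy_schwarz _ _).
Qed.

Lemma rn_sym_prod u : rn (sym_prod u : T) <= \prod_i rn (u i).
Proof.
rewrite -rn_tpow; apply: rn_le_of_inner.
by rewrite inner_sym_prodl //; exact: sym_prod_symmetric.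
Qed.

Lemma sym_prod_bounded u (i : 'I_n) :
  bounded_linear (fun x => sym_prod [eta u with i |-> x] : T).
Proof.
split; first exact: sym_prod_linear.
exists (\prod_(j | j != i) rn (u j)) => [|x].
  by apply: prodr_ge0 => j _; exact: rn_ge0.
apply: le_trans (rn_sym_prod _) _; rewrite (bigD1 i) //= eqxx mulrC.
by rewrite le_eqVlt; apply/orP; left; apply/eqP; congr (_ * _);
  apply: eq_bigr => j /negPf ->.
Qed.

(** [Q] attaches to an approximant [s] its symmetrisation [s'], characterised by pairings instead of
    by a projection operator. As [t] is symmetric, t - s' is the projection of t - s and so is not
    longer. *)
Lemma sym_prod_total t : symmetric_tensor t ->
  cl (lspan (range (sym_prod : ('I_n -> U) -> T))) t.
Proof.
move=> st e e0; have [|s hs ts] := (dense_cl _).1 (@tpow_total _ _ _ T) t e => //.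
pose Q (s : T) := exists2 s' : T, lspan (range (sym_prod : ('I_n -> U) -> T)) s' &
  symmetric_tensor s' /\
  forall t', symmetric_tensor t' -> inner s' t' = inner s t'.
have Qs : linear_subspace Q.
  have [L0 L1] := lspan_subspace (range (sym_prod : ('I_n -> U) -> T)).
  have [S0 S1] := symmetric_subspace.
  split; first by exists 0 => //; split=> // t' _; rewrite !inner0l.
  move=> a x y [x' lx [sx hx]] [y' ly [sy hy]]; exists (a *: x' + y').
    exact: L1.
  split=> [|t' st']; first exact: S1.
  by rewrite !innerDl !innerZl hx // hy.
have /(_ _ hs) [s' ls [ss hs']] : lspan (range (tpow T)) `<=` Q.
  apply: lspan_min => // _ [u _ <-]; exists (sym_prod u).
    by apply: lspan_gen; exists u.
  by split=> [|t' st']; [exact: sym_prod_symmetric | exact: inner_sym_prodl].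
exists s' => //; apply: le_lt_trans ts; apply: rn_le_of_inner.
have sd : symmetric_tensor (t - s').
  exact: (subspaceB symmetric_subspace st ss).
by rewrite !innerBl (hs' _ sd).
Qed.

End SymmetricTensors.

(** * Creation and annihilation operators on the Fock space *)

Section Fock.
Context {R : realType} {U : hilbertType R} {w : nat -> R}.
Context {T : forall n, tensor_power U n} (F : fock_space w T).
Hypothesis w_gt0 : forall n, 0 < w n.

Definition symvec n (u : 'I_n -> U) : F := fock_incl F (sym_prod u : T n).
Definition create (u : U) : F -> F := vee (symvec (fun _ : 'I_1 => u)).

Lemma inner_symvec_neq m n (u : 'I_m -> U) (v : 'I_n -> U) : m != n ->
  inner (symvec u) (symvec v) = 0.
Proof.
by move=> mn; apply: fock_incl_orthogonal => //; exact: sym_prod_symmetric.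
Qed.

Lemma inner_symvec n (u v : 'I_n -> U) :
  inner (symvec u) (symvec v) =
  (w n ^+ 2)%:C * ((n`!%:R)^-1 * \sum_(s : 'S_n) \prod_i inner (u i) (v (s i))).
Proof.
rewrite fock_incl_inner ?inner_sym_prod //; exact: sym_prod_symmetric.
Qed.

Lemma fock_incl0 n : fock_incl F (0 : T n) = 0.
Proof.
have [S0 _] := @symmetric_subspace R U n (T n).
have := fock_incl_linear F 1 S0 S0; rewrite !scale1r addr0 => e.
by apply: (addrI (fock_incl F (0 : T n))); rewrite addr0.
Qed.

Lemma rn_fock_incl n (t : T n) : symmetric_tensor t ->
  rn (fock_incl F t) = w n * rn t.
Proof.
move=> st; apply/eqP; rewrite -(@eqrXn2 _ 2) ?rn_ge0 ?mulr_ge0 ?rn_ge0 ?ltW //.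
apply/eqP/complexI; rewrite -inner_rn fock_incl_inner // inner_rn.
by rewrite -rmorphM -exprMn.
Qed.

Lemma symvec_linear n (u : 'I_n -> U) (i : 'I_n) :
  linear (fun x => symvec [eta u with i |-> x]).
Proof.
move=> a x y; rewrite /symvec sym_prod_linear fock_incl_linear //;
  exact: sym_prod_symmetric.
Qed.

Lemma symvec_bounded n (u : 'I_n -> U) (i : 'I_n) :
  bounded_linear (fun x => symvec [eta u with i |-> x]).
Proof.
split; first exact: symvec_linear.
have [_ [C C0 h]] := @sym_prod_bounded R U n (T n) u i.
exists (w n * C) => [|x]; first by rewrite mulr_ge0 // ltW.
rewrite rn_fock_incl; last exact: sym_prod_symmetric.
by rewrite -mulrA ler_wpM2l // ltW.
Qed.

Definition symvecs (W : set U) : set F :=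
  [set x | exists n (u : 'I_n -> U), (forall i, W (u i)) /\ x = symvec u].

Lemma symvec_total x : cl (lspan (symvecs setT)) x.
Proof.
have Lc := cl_subspace (lspan_subspace (symvecs setT)).
have /cl_mono : lspan [set x | exists n (t : T n),
    symmetric_tensor t /\ x = fock_incl F t] `<=` cl (lspan (symvecs setT)).
  apply: lspan_min => // _ [n [t [st ->]]] e e0.
  (* [fock_incl] multiplies norms in degree n by [w n]. *)
  have ew : 0 < e / w n by rewrite divr_gt0.
  have [s hs ts] := sym_prod_total st ew.
  pose Q (s : T n) := symmetric_tensor s /\ lspan (symvecs setT) (fock_incl F s).
  have /(_ _ hs) [ss ls] :
      lspan (range (sym_prod : ('I_n -> U) -> T n)) `<=` Q.
    have [S0 S1] := @symmetric_subspace R U n (T n).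
    have [L0 L1] := lspan_subspace (symvecs setT).
    apply: lspan_min.
      split; first by split=> //; rewrite fock_incl0.
      move=> a x' y [sx lx] [sy ly]; split; first exact: S1.
      by rewrite fock_incl_linear //; exact: L1.
    move=> _ [u _ <-]; split; first exact: sym_prod_symmetric.
    by apply: lspan_gen; exists n, u.
  exists (fock_incl F s) => //.
  have -> : fock_incl F t - fock_incl F s = fock_incl F (t - s).
    by rewrite -scaleN1r addrC -fock_incl_linear // scaleN1r addrC.
  rewrite rn_fock_incl; first by rewrite mulrC -ltr_pdivlMr.
  exact: (subspaceB (@symmetric_subspace _ _ _ _) st ss).
by move=> h; apply/cl_idem/h; apply: ((dense_cl _).1 (@fock_incl_total _ _ _ _ F)).
Qed.

(** The factors are moved into [W] one at a time, using continuity in each; only the positions below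
    [k] may still hold arbitrary vectors. *)
Lemma symvec_dense (W : set U) : (forall x, cl W x) ->
  forall x, cl (lspan (symvecs W)) x.
Proof.
move=> dW; have Lc := cl_subspace (lspan_subspace (symvecs W)).
suff h n (u : 'I_n -> U) : cl (lspan (symvecs W)) (symvec u).
  move=> x; apply: cl_idem; apply: cl_mono (symvec_total x).
  by apply: lspan_min => // _ [n [u [_ ->]]].
suff : forall k (u : 'I_n -> U), (forall i : 'I_n, (k <= i)%N -> W (u i)) ->
    cl (lspan (symvecs W)) (symvec u).
  by move/(_ n); apply=> i; rewrite leqNgt ltn_ord.
elim=> [|k IH] {}u hu.
  by apply: sub_cl; apply: lspan_gen; exists n, u; split=> // i; exact: hu.
have [kn|nk] := ltnP k n; last first.
  by apply: IH => i ki; have := leq_trans nk ki; rewrite leqNgt ltn_ord.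
pose i0 := Ordinal kn.
have -> : u = [eta u with i0 |-> u i0].
  by apply/funext => i /=; case: eqP => [->|].
apply: cl_idem => e e0.
apply: (bounded_linear_cl (symvec_bounded u i0) (dW (u i0)) _ e0).
move=> _ [y Wy <-]; apply: IH => i ki /=; case: eqP => [//|/eqP ii0].
apply: hu; rewrite ltn_neqAle ki andbT; apply: contra ii0 => /eqP ki0.
exact/eqP/val_inj.
Qed.

Definition fcons n (u : U) (v : 'I_n -> U) : 'I_n.+1 -> U :=
  fun i => if unlift ord0 i is Some j then v j else u.

Lemma fcons0 n u (v : 'I_n -> U) : fcons u v ord0 = u.
Proof. by rewrite /fcons unlift_none. Qed.

Lemma fconsS n u (v : 'I_n -> U) i : fcons u v (lift ord0 i) = v i.
Proof. by rewrite /fcons liftK. Qed.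

Lemma create_symvec u n (v : 'I_n -> U) : create u (symvec v) = symvec (fcons u v).
Proof.
rewrite /create /symvec vee_sym_prod; congr (fock_incl F (sym_prod _)).
apply/funext => i; rewrite /fun_cat.
case: (unliftP ord0 i) => [j|] ->; [rewrite fconsS | rewrite fcons0].
  case: splitP => [k|k /= e]; first by rewrite (ord1 k).
  by congr v; apply: val_inj; rewrite /= /bump /= in e *; case: e.
by case: splitP.
Qed.

Lemma create_bounded u : bounded_linear (create u).
Proof.
split; first by move=> a x y; rewrite /create vee_linear.
have [C hC] := vee_bounded F; set z := symvec (fun _ : 'I_1 => u).
exists (rn (C * `|z|)) => [|x]; first exact: rn_ge0.
rewrite -lecR rmorphM /= -!normE_rn; have h := hC z x; apply: (le_trans h).
(* [C] is an arbitrary complex number, but the bound dominates a norm, so it is nonnegative and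
   equals its own modulus. *)
have h0 := le_trans (normr_ge0 _) h.
by rewrite -[leLHS](ger0_norm h0) normrM normr_id.
Qed.

(** Expansion of the permanent along the row of [u]. The scalar is what remains of the squared
    weights and of the factorials in degrees k+1 and k. *)
Lemma inner_create_symvec u k (x : 'I_k -> U) (y : 'I_k.+1 -> U) :
  inner (create u (symvec x)) (symvec y) =
  ((w k.+1 / w k) ^+ 2 / k.+1%:R)%:C *
    \sum_j inner u (y j) * inner (symvec x) (symvec (y \o lift j)).
Proof.
rewrite create_symvec inner_symvec.
rewrite (permanent_expand (fun i j => inner (fcons u x i) (y j))).
rewrite fcons0 !mulr_sumr; apply: eq_bigr => j _.
rewrite inner_symvec /=; under eq_bigr do under eq_bigr do rewrite fconsS.
rewrite !mulrA; congr (_ * _).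
have wk : (w k)%:C != 0 :> R[i] by rewrite fmorph_eq0 gt_eqF.
have kn : (k`!%:R : R[i]) != 0 by rewrite pnatr_eq0 -lt0n fact_gt0.
have k1 : (k.+1%:R : R[i]) != 0 by rewrite pnatr_eq0.
have -> : ((w k.+1 / w k) ^+ 2 / k.+1%:R)%:C =
    (w k.+1)%:C ^+ 2 / (w k)%:C ^+ 2 / k.+1%:R.
  by rewrite rmorphM fmorphV rmorph_nat rmorphXn /= rmorphM fmorphV /= expr_div_n.
rewrite factS natrM invfM !rmorphXn /=.
by field; rewrite nat1r kn k1 wk.
Qed.

Definition annihilate (u : U) : F -> F := adj (create u).

(** The candidate for the adjoint of [create u]: [u] is contracted with each factor in turn, and the
    vacuum is sent to 0. The scalar is the one of [inner_create_symvec]. *)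
Definition annih_value u n : ('I_n -> U) -> F :=
  match n with
  | 0 => fun _ => 0
  | k.+1 => fun y => ((w k.+1 / w k) ^+ 2 / k.+1%:R)%:C *:
       \sum_j inner u (y j) *: symvec (y \o lift j)
  end.

Lemma inner_symvec_create u n (y : 'I_n -> U) z :
  inner (symvec y) (create u z) = inner (annih_value u y) z.
Proof.
have bc := create_bounded u.
suff e : inner (symvec y) \o create u = inner (annih_value u y).
  by have /= -> := congr1 (@^~ z) e.
apply: (bounded_linear_dense_eq (bounded_linear_comp (bounded_linear_inner _) bc)
  (bounded_linear_inner _) symvec_total).
apply: lspan_min.
  split=> [|a s t /= hs ht]; first by rewrite /= (lin0 bc.1) !inner0r.
  by rewrite bc.1 !inner_linear hs ht.
move=> _ [m [x [_ ->]]] /=.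
case: n y => [|k] y /=.
  by rewrite inner0l create_symvec inner_symvec_neq.
rewrite innerZl inner_suml conjc_real.
have [mk|mk] := eqVneq m k; last first.
  rewrite create_symvec inner_symvec_neq ?eqSS 1?eq_sym //.
  rewrite big1 ?mulr0 // => j _.
  by rewrite innerZl inner_symvec_neq ?mulr0 // eq_sym.
subst m; rewrite innerC inner_create_symvec rmorphM rmorph_sum.
congr (_ * _); first exact: conjc_real.
by apply: eq_bigr => j _; rewrite innerZl rmorphM [inner (symvec (y \o _)) _]innerC.
Qed.

(** The explicit values put the symmetric products into the domain of the adjoint; they span a dense
    subspace, so [adjpair_exists] applies. *)
Lemma annihilate_bounded_adjpair u :
  bounded_linear (annihilate u) /\ adjpair (create u) (annihilate u).
Proof.
have [|b bb ab] := adjpair_exists (create_bounded u) symvec_total; last first.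
  by rewrite /annihilate (adjpair_adj ab).
apply: lspan_min.
  split; first by exists 0 => f; rewrite !inner0l.
  move=> a s t [z hz] [z' hz']; exists (a *: z + z') => f.
  by rewrite !innerDl !innerZl hz hz'.
by move=> _ [m [x [_ ->]]]; exists (annih_value u x); exact: inner_symvec_create.
Qed.

Lemma annihilate_bounded u : bounded_linear (annihilate u).
Proof. by case: (annihilate_bounded_adjpair u). Qed.

Lemma annihilateP u : adjpair (create u) (annihilate u).
Proof. by case: (annihilate_bounded_adjpair u). Qed.

Lemma annihilate_symvec u n (y : 'I_n -> U) :
  annihilate u (symvec y) = annih_value u y.
Proof.
by apply: inner_extl => z; rewrite -annihilateP inner_symvec_create.
Qed.

End Fock.

Arguments symvecs {R U w T} F W _.
Arguments create {R U w T} F u _.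
Arguments annihilate {R U w T} F u _.
Arguments symvec_dense {R U w T} F w_gt0 [W] _ x.
Arguments create_bounded {R U w T} F u.
Arguments annihilate_bounded {R U w T} F w_gt0 u.
Arguments symvec_total {R U w T} F w_gt0 x.

(** * The derivation of the Fock space induced by a skew operator *)

Section FockDerivation.
Context {R : realType} {U : hilbertType R} {w : nat -> R}.
Context {T : forall n, tensor_power U n} (F : fock_space w T).
Hypothesis w_gt0 : forall n, 0 < w n.
Context (W : set U) (l : U -> U).
Hypothesis W_dense : forall x, cl W x.
Hypothesis l_skew : forall x y, W x -> W y -> inner x (l y) = - inner (l x) y.

Definition leibniz n (u : 'I_n -> U) : F :=
  \sum_i symvec F [eta u with i |-> l (u i)].

(** Convertible to [Dop] when [W] is [K0] and [l] is [opapp Lop]. *)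
Definition derivation : set (F * F) :=
  lspan [set p | exists n (u : 'I_n -> U), (forall i, W (u i)) /\
    p = (symvec F u, leibniz u)].

Lemma derivation_symvec n (u : 'I_n -> U) : (forall i, W (u i)) ->
  derivation (symvec F u, leibniz u).
Proof. by move=> Wu; apply: lspan_gen; exists n, u. Qed.

Lemma inner_leibniz_neq m n (u : 'I_m -> U) (v : 'I_n -> U) : m != n ->
  inner (symvec F u) (leibniz v) = 0.
Proof.
by move=> mn; rewrite inner_sumr big1 // => i _; exact: inner_symvec_neq.
Qed.

Lemma leibniz_skew n (u v : 'I_n -> U) :
  (forall i, W (u i)) -> (forall i, W (v i)) ->
  inner (symvec F u) (leibniz v) = - inner (leibniz u) (symvec F v).
Proof.
move=> Wu Wv; rewrite inner_sumr inner_suml -sumrN.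
under eq_bigr do rewrite inner_symvec mulr_sumr mulr_sumr.
under [RHS]eq_bigr do rewrite inner_symvec mulr_sumr mulr_sumr -sumrN.
rewrite exchange_big [RHS]exchange_big /=; apply: eq_bigr => s _.
(* For fixed s, the entry [s k] of [v] is paired with the entry [k] of [u]: letting [l] act on the
   former matches letting it act on the latter, up to sign. *)
rewrite (reindex_inj (@perm_inj _ s)); apply: eq_bigr => k _ /=.
rewrite (bigD1 k) //= [in RHS](bigD1 k) //= !eqxx l_skew // mulNr !mulrN.
congr (- (_ * (_ * (_ * _)))); apply: eq_bigr => j jk.
by rewrite (inj_eq (@perm_inj _ s)) (negPf jk).
Qed.

Lemma derivation_skew p q : derivation p -> derivation q ->
  inner p.1 q.2 = - inner p.2 q.1.
Proof.
move=> Dp; move: q; apply: lspan_min.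
  split=> [|a s t hs ht]; first by rewrite /= !inner0r oppr0.
  by rewrite /= !inner_linear hs ht opprD mulrN.
move=> _ [n [v [Wv ->]]] /=; move: p Dp; apply: lspan_min.
  split=> [|a s t hs ht]; first by rewrite /= !inner0l oppr0.
  by rewrite /= !innerDl !innerZl hs ht opprD mulrN.
move=> _ [m [u [Wu ->]]] /=.
have [mn|mn] := eqVneq m n; first by subst m; exact: leibniz_skew.
by rewrite inner_leibniz_neq // innerC inner_leibniz_neq 1?eq_sym // conjc0 oppr0.
Qed.

Lemma derivation_dense x : cl (opdom derivation) x.
Proof.
suff h : lspan (symvecs F W) `<=` opdom derivation.
  exact: cl_mono h _ (symvec_dense F w_gt0 W_dense x).
apply: lspan_min.
  have [D0 D1] := lspan_subspace [set p : F * F | exists n (u : 'I_n -> U),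
    (forall i, W (u i)) /\ p = (symvec F u, leibniz u)].
  split; first by exists 0.
  by move=> a s t [s' hs] [t' ht]; exists (a *: s' + t'); exact: D1 hs ht.
move=> _ [n [u [Wu ->]]]; exists (leibniz u); exact: derivation_symvec.
Qed.

(** In the Leibniz sum of u v v_1 v ... v v_n, the summand where [l] hits the head is the
    commutator; the others form [create u] of the Leibniz sum of the v_i. *)
Lemma create_commutator u : W u ->
  commutator_on derivation (create F u) (create F (l u)).
Proof.
move=> Wu x y; have [lu _] := create_bounded F u.
have [llu _] := create_bounded F (l u).
have Ds := lspan_subspace [set p : F * F | exists n (u : 'I_n -> U),
    (forall i, W (u i)) /\ p = (symvec F u, leibniz u)].
suff: derivation `<=` [set p | derivation (create F u p.1,
    create F (l u) p.1 + create F u p.2)] by move=> h /h.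
apply: lspan_min.
  split; first by rewrite /= (lin0 lu) (lin0 llu) addr0; case: Ds.
  move=> a s t /= hs ht; rewrite lu llu lu addrACA -scalerDr.
  by case: Ds => _ D1; exact: D1 hs ht.
move=> _ [n [v [Wv ->]]] /=.
have -> : create F (l u) (symvec F v) + create F u (leibniz v) = leibniz (fcons u v).
  rewrite /leibniz big_ord_recl fcons0 lin_sum //; congr (_ + _).
    rewrite create_symvec; congr symvec; apply/funext => i /=.
    by case: (unliftP ord0 i) => [j|] ->; rewrite ?fconsS ?fcons0.
  apply: eq_bigr => i _; rewrite create_symvec fconsS; congr symvec.
  apply/funext => k /=; case: (unliftP ord0 k) => [j|] ->.
    by rewrite !fconsS /= (inj_eq (@lift_inj _ _)).
  by rewrite !fcons0.
rewrite create_symvec; apply: derivation_symvec => i.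
by case: (unliftP ord0 i) => [j|] ->; rewrite ?fconsS ?fcons0.
Qed.

(** The explicit values show that the domain is preserved. The value [z] of the derivation is then
    found by duality: against a vector [q] of the dense domain, skewness carries the computation
    over to [create_commutator]. *)
Lemma annihilate_commutator u : W u ->
  commutator_on derivation (annihilate F u) (annihilate F (l u)).
Proof.
move=> Wu x y Dxy; have [la _] := annihilate_bounded F w_gt0 u.
have Ds := lspan_subspace [set p : F * F | exists n (u : 'I_n -> U),
    (forall i, W (u i)) /\ p = (symvec F u, leibniz u)].
have [z Dz] : opdom derivation (annihilate F u x).
  move: Dxy; suff: derivation `<=` [set p | opdom derivation (annihilate F u p.1)].
    by move=> h /h.
  have Dd : linear_subspace (opdom derivation).
    case: Ds => D0 D1; split; first by exists 0.
    by move=> a s t [s' hs] [t' ht]; exists (a *: s' + t'); exact: D1 hs ht.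
  apply: lspan_min.
    split; first by rewrite /= lin0 //; case: Dd.
    by move=> a s t /= hs ht; rewrite la; case: Dd => _ D1; exact: D1.
  move=> _ [[|n] [v [Wv ->]]] /=; rewrite annihilate_symvec //=.
    by case: Dd.
  apply: subspaceZ => //; apply: subspace_sum => // j _; apply: subspaceZ => //.
  by eexists; apply: derivation_symvec => i /=; exact: Wv.
suff -> : annihilate F (l u) x + annihilate F u y = z by [].
apply: inner_dense_eq derivation_dense _ => q [q' Dq]; apply/esym.
have /= e0 := derivation_skew Dz Dq; rewrite -[LHS]opprK -e0.
rewrite -annihilateP // innerDl -!annihilateP //.
have := derivation_skew Dxy (create_commutator Wu Dq); rewrite /= innerDr => e.
have -> : inner x (create F u q') =
  - inner y (create F u q) - inner x (create F (l u) q) by rewrite -e addrC addKr.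
by rewrite opprB opprK.
Qed.

End FockDerivation.

(** * Tails of convergent series *)

Section SeriesTail.
Context {R : realType}.
Implicit Types f g : nat -> R.

Definition tail f m : R := limn (series f) - series f m.

Lemma tail_cvg f m : cvgn (series f) ->
  (fun N => \sum_(m <= n < N) f n) @ \oo --> tail f m.
Proof.
move=> cf.
have h : series f N - series f m @[N --> \oo] --> tail f m.
  by apply: cvgB; [exact: cf | exact: cvg_cst].
apply: cvg_trans h; apply: near_eq_cvg; near=> N.
have mN : (m <= N)%N by near: N; exact: nbhs_infty_ge.
by rewrite sub_series_geq.
Unshelve. all: by end_near. Qed.

Lemma tail_cvg0 f : cvgn (series f) -> tail f @ \oo --> (0 : R).
Proof.
move=> cf; rewrite -(subrr (limn (series f))).
by apply: cvgB; [exact: cvg_cst | exact: cf].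
Qed.

Lemma tail_split f m : tail f m = f m + tail f m.+1.
Proof. by rewrite /tail seriesSr; ring. Qed.

Lemma tail_le f g m c : cvgn (series f) -> cvgn (series g) ->
  (forall n, (m <= n)%N -> f n <= c * g n) -> tail f m <= c * tail g m.
Proof.
move=> cf cg fg.
have h1 := tail_cvg (m := m) cf.
have h2 : (fun N => c * \sum_(m <= n < N) g n) @ \oo --> c * tail g m.
  by apply: cvgM; [exact: cvg_cst | exact: tail_cvg].
rewrite -(cvg_lim (@Rhausdorff _) h1) -(cvg_lim (@Rhausdorff _) h2).
apply: ler_lim; [by apply/cvg_ex; eexists; exact: h1
               | by apply/cvg_ex; eexists; exact: h2 | ].
apply: nearW => N; rewrite mulr_sumr.
by apply: ler_sum_nat => n /andP[mn _]; exact: fg.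
Qed.

Lemma tail_ge f m N : cvgn (series f) -> (forall n, 0 <= f n) ->
  \sum_(m <= n < N) f n <= tail f m.
Proof.
move=> cf f0; rewrite -(cvg_lim (@Rhausdorff _) (tail_cvg (m := m) cf)).
have cc := tail_cvg (m := m) cf; apply: (nondecreasing_cvgn_le _ _ N) => //.
  apply/nondecreasing_seqP => k.
  have [mk|km] := leqP m k; last by rewrite !big_geq // ltnW.
  by rewrite big_nat_recr //= lerDl.
by apply/cvg_ex; eexists; exact: cc.
Qed.

End SeriesTail.

(** * Asymptotics of the coherent vectors *)

Section Coherent.
Context {R : realType} {U : hilbertType R} {w : nat -> R}.
Context {T : forall n, tensor_power U n} (F : fock_space w T).
Hypothesis w_gt0 : forall n, 0 < w n.
Hypothesis w_sum : cvgn (series (fun n => (w n) ^- 2)).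
Hypothesis w_ratio : (fun n => w n.+1 / w n) @ \oo --> (1 : R).
Context (xi : U).
Hypothesis xi1 : rn xi = 1.

Let mass n : R := (w n) ^- 2.
Let pow n : F := symvec F (fun _ : 'I_n => xi).
Let term n : F := (mass n)%:C *: pow n.

(** Written out so that it is convertible to [Kx x m] when [xi] is the vector e_1 (x) k_x. *)
Definition kappa m : F := limn (fun N => \sum_(m <= n < N) (((w n) ^- 2)%:C *:
  symvec F (fun _ : 'I_n => xi))).

Let mass_gt0 n : 0 < mass n.
Proof. by rewrite invr_gt0 exprn_gt0. Qed.

Let mass_ge0 n : 0 <= mass n.
Proof. by rewrite ltW. Qed.

Let massw n : mass n * w n ^+ 2 = 1.
Proof. by rewrite mulVf // gt_eqF // exprn_gt0. Qed.

Lemma inner_pow n (y : 'I_n -> U) :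
  inner (pow n) (symvec F y) = (w n ^+ 2)%:C * \prod_i inner xi (y i).
Proof.
rewrite inner_symvec //; congr (_ * _).
have -> : \sum_(s : 'S_n) \prod_i inner xi (y (s i)) = n`!%:R * \prod_i inner xi (y i).
  rewrite mulr_natl -[in RHS](card_Sn n) -sumr_const; apply: eq_bigr => s _.
  by rewrite [RHS](reindex_inj (@perm_inj _ s)).
by rewrite mulrA mulVf ?mul1r // pnatr_eq0 -lt0n fact_gt0.
Qed.

(** The coefficient w(n)^-2 of the series cancels the weight w(n)^2 of the inner product. What is
    left is multiplicative in the factors of [y], the source of all eigenvector relations below. *)
Lemma inner_term_symvec n k (y : 'I_k -> U) :
  inner (term n) (symvec F y) = (n == k)%:R * \prod_i inner xi (y i).
Proof.
rewrite innerZl conjc_real; have [nk|nk] := eqVneq n k; last first.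
  by rewrite inner_symvec_neq // mulr0 mul0r.
by subst n; rewrite inner_pow mulrA -rmorphM massw.
Qed.

Lemma inner_term n k : inner (term n) (term k) = ((n == k)%:R * mass n)%:C.
Proof.
rewrite innerZr inner_term_symvec inner_rn xi1 expr1n big1 // mulr1.
by rewrite rmorphM rmorph_nat mulrC; case: eqP => [->|]; rewrite ?mul0r.
Qed.

Let S m N : F := \sum_(m <= n < N) term n.

Lemma rn_orthogonal_sum (e : nat -> F) (c : nat -> R) m N :
  (forall i j, inner (e i) (e j) = ((i == j)%:R * c i)%:C) ->
  rn (\sum_(m <= n < N) e n) ^+ 2 = \sum_(m <= n < N) c n.
Proof.
move=> ec; apply: complexI; rewrite -inner_rn inner_suml rmorph_sum.
apply: eq_big_nat => i /andP[mi iN]; rewrite inner_sumr.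
rewrite (bigD1_seq i) ?mem_index_iota ?mi ?iota_uniq //= ec eqxx mul1r.
by rewrite big1 ?addr0 // => j ji; rewrite ec eq_sym (negPf ji) mul0r.
Qed.

Lemma rn_S m N : rn (S m N) ^+ 2 = \sum_(m <= n < N) mass n.
Proof. exact: rn_orthogonal_sum inner_term. Qed.

Lemma kappa_cvg m : S m @ \oo --> kappa m.
Proof.
suff : cvgn (S m) by [].
(* The terms are orthogonal with square norms [mass], so every block starting at N or later has norm
   at most the root of the tail. *)
apply: (@cauchy_rn_cvg _ _ _ (fun N => Num.sqrt (tail mass N))).
  rewrite -sqrtr0; apply: cvg_comp (tail_cvg0 w_sum) _; exact: sqrt_continuous.
move=> N N' NN'.
have tN : 0 <= tail mass N.
  apply: le_trans (tail_ge N N w_sum _); first by rewrite big_geq.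
  by move=> n; exact: mass_ge0.
rewrite rnB -[leLHS]ger0_norm ?rn_ge0 // -sqrtr_sqr ler_wsqrtr //.
have [mN|Nm] := leqP m N.
  rewrite /S (big_cat_nat mN NN') /= addrAC subrr add0r.
  rewrite -/(S N N') rn_S; exact: tail_ge.
have [mN'|N'm] := leqP m N'; last first.
  by rewrite /S !big_geq ?subr0 ?rn0 ?expr0n // ltnW.
rewrite {2}/S big_geq ?subr0; last exact: ltnW.
rewrite rn_S; apply: le_trans (tail_ge N N' w_sum _); last by exact: mass_ge0.
rewrite [leRHS](big_cat_nat (ltnW Nm) mN') /= lerDr sumr_ge0 // => n _.
exact: mass_ge0.
Qed.

Arguments kappa_cvg : clear implicits.

Lemma inner_cvg_eventually (z : nat -> F) l y c N0 : z @ \oo --> l ->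
  (forall N, (N0 <= N)%N -> inner (z N) y = c) -> inner l y = c.
Proof.
move=> /cvg_rn zl h; apply/subr0_eq/rn_eq0/eqP; rewrite eq_le rn_ge0 andbT.
have zl' := cvg0M (rn y) zl.
rewrite -(cvg_lim (@Rhausdorff _) zl').
apply: limr_ge; first by apply/cvg_ex; exists 0.
near=> N; rewrite -(h N); first by rewrite -innerBl; exact: inner_cauchy_schwarz.
by near: N; exact: nbhs_infty_ge.
Unshelve. all: by end_near. Qed.

Lemma inner_kappa_symvec m k (y : 'I_k -> U) :
  inner (kappa m) (symvec F y) = (m <= k)%:R * \prod_i inner xi (y i).
Proof.
(* Terms of degree above k are orthogonal to [symvec F y], so the pairing is constant from N = k+1
   on. *)
apply: (inner_cvg_eventually (N0 := k.+1) (kappa_cvg m)) => N kN.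
rewrite inner_suml; apply: etrans (eq_bigr _ (fun n _ => inner_term_symvec n y)) _.
rewrite -mulr_suml; congr (_ * _).
have [mk|km] := leqP m k.
  rewrite (bigD1_seq k) ?mem_index_iota ?mk ?iota_uniq //= eqxx big1 ?addr0 //.
  by move=> j /negPf ->.
rewrite big_nat_cond big1 // => j; rewrite andbT => /andP[mj _].
by rewrite gtn_eqF // (leq_trans km).
Qed.

Lemma inner_kappa_term m n : inner (kappa m) (term n) = ((m <= n)%:R * mass n)%:C.
Proof.
rewrite innerZr inner_kappa_symvec inner_rn xi1 expr1n big1 // mulr1.
by rewrite rmorphM rmorph_nat mulrC.
Qed.

Lemma Re_inner_cvg (z : nat -> F) l y : z @ \oo --> l ->
  (fun N => complex.Re (inner y (z N))) @ \oo --> complex.Re (inner y l).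
Proof.
move=> /cvg_rn zl; apply/cvgrPdist_le => e e0.
have /cvgrPdist_le/(_ _ e0) := cvg0M (rn y) zl; apply: filterS => N.
rewrite sub0r normrN ger0_norm ?mulr_ge0 ?rn_ge0 //; apply: le_trans.
rewrite -raddfB -innerBr mulrC; apply: le_trans (inner_cauchy_schwarz _ _).
by rewrite -lecR -normE_rn normc_ge_Re.
Qed.

Lemma rn_kappa m : rn (kappa m) ^+ 2 = tail mass m.
Proof.
rewrite rn_sqrE; apply/esym.
have h := Re_inner_cvg (y := kappa m) (kappa_cvg m).
rewrite -(cvg_lim (@Rhausdorff _) h)
  -(cvg_lim (@Rhausdorff _) (tail_cvg (m := m) w_sum)).
congr (limn _); apply/funext => N.
rewrite inner_sumr raddf_sum /=; apply: eq_big_nat => n /andP[mn _].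
by rewrite inner_kappa_term mn mul1r.
Qed.

Lemma kappa_split m : kappa m = term m + kappa m.+1.
Proof.
apply: inner_lspan_eq (symvec_total F w_gt0) _ => _ [k [y [_ ->]]].
rewrite innerDl !inner_kappa_symvec inner_term_symvec -mulrDl -natrD.
by congr (_%:R * _); case: ltngtP.
Qed.

(** Pairings with [kappa] are multiplicative, so testing against u v y splits off <xi, u>; the index
    drops by one because u v y has one factor more than y. *)
Lemma annihilate_kappa u m :
  annihilate F u (kappa m.+1) = (inner xi u)^*%C *: kappa m.
Proof.
apply: inner_lspan_eq (symvec_total F w_gt0) _ => _ [k [y [_ ->]]].
rewrite -annihilateP // create_symvec inner_kappa_symvec innerZl conjcK.
rewrite inner_kappa_symvec big_ord_recl fcons0 ltnS mulrCA; congr (_ * (_ * _)).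
by apply: eq_bigr => i _; rewrite fconsS.
Qed.

Lemma tail_mass_gt0 m : 0 < tail mass m.
Proof.
by apply: lt_le_trans (tail_ge m m.+1 w_sum mass_ge0); rewrite big_nat1; exact: mass_gt0.
Qed.

Lemma rn_kappa_gt0 m : 0 < rn (kappa m).
Proof.
rewrite lt0r rn_ge0 andbT -sqrf_eq0 rn_kappa gt_eqF //; exact: tail_mass_gt0.
Qed.

(** Eventually mass n <= (1 + e) mass (n+1). Summing over n >= m bounds tail m by (1 + e) tail
    (m+1), and subtracting tail (m+1) leaves mass m <= e tail (m+1). *)
Lemma mass_tail_cvg0 : (fun m => mass m / tail mass m.+1) @ \oo --> (0 : R).
Proof.
have r1 : (fun n => w n.+1 / w n * (w n.+1 / w n)) @ \oo --> (1 : R).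
  have h := cvgM w_ratio w_ratio; rewrite mulr1 in h; exact: h.
apply/cvgrPdist_le => e e0.
have /cvgrPdist_le/(_ _ e0) [M _ hM] := r1.
exists M => // m /= Mm; rewrite sub0r normrN.
have t0 := tail_mass_gt0 m.+1.
rewrite ger0_norm; last by rewrite divr_ge0 ?(ltW t0).
rewrite ler_pdivrMr //.
have sm : cvgn (series (fun n => mass n.+1)).
  have /cvg_ex [l hl] := w_sum; apply/cvg_ex; exists (l - mass 0%N).
  have -> : series (fun n => mass n.+1) = (fun n => series mass n.+1 - mass 0%N).
    by apply/funext => n; rewrite /series /= big_nat_recl //= addrAC subrr add0r.
  by apply: cvgB; [rewrite (cvg_shiftS (series mass)); exact: hl | exact: cvg_cst].
have tm : tail (fun n => mass n.+1) m = tail mass m.+1.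
  have h := tail_cvg (m := m) sm.
  rewrite -(cvg_lim (@Rhausdorff _) h); apply: (cvg_lim (@Rhausdorff _)).
  have := tail_cvg (m := m.+1) w_sum; rewrite -cvg_shiftS; apply: cvg_trans.
  apply: near_eq_cvg; apply: nearW => N.
  by rewrite /= big_add1.
have : tail mass m <= (1 + e) * tail (fun n => mass n.+1) m.
  apply: tail_le => // n mn; have /= := hM n (leq_trans Mm mn).
  rewrite ler_norml => /andP[+ _]; rewrite lerNl opprB lerBlDl => h.
  have e1 : mass n = w n.+1 / w n * (w n.+1 / w n) * mass n.+1.
    by rewrite /mass; field; rewrite !gt_eqF.
  by rewrite e1 ler_wpM2r.
by rewrite tm (tail_split mass m) mulrDl mul1r [leRHS]addrC lerD2r.
Qed.

(** The relative error in norm is controlled, not just the expectation value: this is what survives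
    composition of bounded operators. *)
Definition approx_eigen (a : F -> F) (c : R[i]) :=
  (fun m => rn (a (kappa m) - c *: kappa m) / rn (kappa m)) @ \oo --> (0 : R).

(** The error at index m+1 is exactly the conjugate of <xi, u> times the single term of degree m,
    the difference of [kappa m] and [kappa m.+1]. *)
Lemma annihilate_approx u : approx_eigen (annihilate F u) (inner xi u)^*%C.
Proof.
rewrite /approx_eigen -cvg_shiftS.
have -> : (fun m => rn (annihilate F u (kappa m.+1) -
    (inner xi u)^*%C *: kappa m.+1) / rn (kappa m.+1)) =
    (fun m => Num.sqrt (mass m / tail mass m.+1) * rn (inner xi u)).
  apply/funext => m; rewrite annihilate_kappa -scalerBr kappa_split addrK.
  rewrite rnZ rn_conj -mulrA mulrC; congr (_ * _).
  rewrite -[LHS]ger0_norm ?divr_ge0 ?rn_ge0 // -sqrtr_sqr exprMn exprVn.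
  rewrite rn_kappa; congr (Num.sqrt (_ / _)).
  apply: complexI; rewrite -inner_rn inner_term eqxx mul1r //.
apply: cvg0M; rewrite -sqrtr0; apply: cvg_comp mass_tail_cvg0 _.
exact: sqrt_continuous.
Qed.

Lemma rn_le_cvg (V : normedModType R[i]) (z : nat -> V) l b :
  z @ \oo --> l -> (forall n, rn (z n) <= b) -> rn l <= b.
Proof.
move=> /cvg_rn zl h; rewrite -subr_le0 -(cvg_lim (@Rhausdorff _) zl).
apply: limr_ge; first by apply/cvg_ex; exists 0.
apply: nearW => n; rewrite lerBlDr -[X in rn X <= _](subrK (z n)).
by apply: le_trans (rnD _ _) _; rewrite lerD2l.
Qed.

(** Contracting [u] with itself contributes |u|^2; contracting it with each of the n copies of [xi]
    contributes |<xi, u>|^2. *)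
Lemma create_pow_sqr u n : inner (create F u (pow n)) (create F u (pow n)) =
  (w n.+1 ^+ 2 * ((rn u ^+ 2 + n%:R * rn (inner xi u) ^+ 2) / n.+1%:R))%:C.
Proof.
have xx : inner xi xi = 1 by rewrite inner_rn xi1 expr1n.
rewrite /pow [X in inner _ X]create_symvec inner_create_symvec // -/(pow n).
rewrite big_ord_recl fcons0 inner_pow.
rewrite big1 ?mulr1 => [|i _]; last by rewrite /= fconsS.
rewrite (eq_bigr (fun=> (w n ^+ 2)%:C * (rn (inner xi u) ^+ 2)%:C)) => [|i _].
  rewrite sumr_const card_ord inner_rn.
  rewrite -[(_ * _) *+ n]mulr_natl -[n%:R in LHS](rmorph_nat (real_complex R)).
  rewrite -!rmorphM -rmorphD -rmorphM; congr (_%:C).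
  by field; rewrite nat1r pnatr_eq0 /= gt_eqF.
rewrite fconsS inner_pow rn_sqr (innerC xi u).
(* With one copy of [xi] removed the list still starts with [u], which supplies the second factor
   <xi, u>. *)
case: n i => [[]|k] i //.
rewrite big_ord_recl big1 ?mulr1 => [|i' _] /=.
  rewrite (_ : lift (lift ord0 i) ord0 = ord0) ?fcons0; last exact: val_inj.
  by ring.
rewrite (_ : lift (lift ord0 i) (lift ord0 i') = lift ord0 (lift i i')) ?fconsS //.
by apply: val_inj; rewrite /= /bump !leq0n !add1n ltnS addnS.
Qed.

(** The cross term is known exactly: passing to the adjoint gives c <kappa m, kappa (m+1)> = c tail
    (m+1). There remains the square norm of u v kappa, an orthogonal sum whose degree n part is
    [mass n * r n] with [r] tending to |c|^2. *)
Lemma create_approx u : approx_eigen (create F u) (inner xi u).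
Proof.
set c := inner xi u.
pose r n := (w n.+1 / w n) ^+ 2 * ((rn u ^+ 2 + n%:R * rn c ^+ 2) / n.+1%:R).
have r_cvg : r @ \oo --> rn c ^+ 2.
  have -> : r = (fun n => (w n.+1 / w n) * (w n.+1 / w n) *
      (rn c ^+ 2 + harmonic n * (rn u ^+ 2 - rn c ^+ 2))).
    apply/funext => n; rewrite /r -expr2; congr (_ * _).
    by rewrite /harmonic /=; field; rewrite nat1r pnatr_eq0.
  have h1 := cvgM w_ratio w_ratio; rewrite mulr1 in h1.
  have h2 : (fun n => rn c ^+ 2 + harmonic n * (rn u ^+ 2 - rn c ^+ 2)) @ \oo
      --> rn c ^+ 2 + 0.
    by apply: cvgD; [exact: cvg_cst | apply: cvg0M; exact: cvg_harmonic].
  have h3 := cvgM (h1 _) h2; rewrite addr0 mul1r in h3; exact: h3.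
have inner_ct i j : inner (create F u (term i)) (create F u (term j)) =
    ((i == j)%:R * (mass i * r i))%:C.
  have [lc _] := create_bounded F u; rewrite /term !(linZ _ _ lc) innerZl innerZr conjc_real.
  have [->|ij] := eqVneq i j; last first.
    by rewrite !create_symvec inner_symvec_neq ?eqSS // !mulr0 mul0r.
  rewrite create_pow_sqr -/c mul1r -!rmorphM; congr (_%:C).
  by rewrite /r /mass; field; rewrite nat1r pnatr_eq0 /= gt_eqF.
have sq m N : rn (create F u (S m N)) ^+ 2 = \sum_(m <= n < N) mass n * r n.
  have [lc _] := create_bounded F u.
  by rewrite lin_sum //; exact: rn_orthogonal_sum inner_ct.
have key m : rn (create F u (kappa m.+1) - c *: kappa m.+1) ^+ 2 =
    rn (create F u (kappa m.+1)) ^+ 2 - rn c ^+ 2 * tail mass m.+1.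
  have e : inner (create F u (kappa m.+1)) (c *: kappa m.+1) =
      (rn c ^+ 2 * tail mass m.+1)%:C.
    rewrite innerZr innerC annihilateP // annihilate_kappa innerZl conjcK -/c.
    rewrite kappa_split innerDl inner_rn rn_kappa.
    rewrite (innerC (kappa m.+1)) inner_kappa_term ltnn mul0r conjc0 add0r.
    by rewrite conjcM conjc_real [RHS]rmorphM /= rn_sqr; ring.
  rewrite rn_subr_sqr e rnZ exprMn rn_kappa /=; ring.
rewrite /approx_eigen -cvg_shiftS; apply/cvgrPdist_le => e e0.
have e2 : 0 < e ^+ 2 by rewrite exprn_gt0.
have /cvgrPdist_le/(_ _ e2) [M _ hM] := r_cvg.
exists M => // m /= Mm; rewrite sub0r normrN ger0_norm ?divr_ge0 ?rn_ge0 //.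
rewrite ler_pdivrMr ?rn_kappa_gt0 // -ler_sqr ?nnegrE ?rn_ge0 ?mulr_ge0 ?rn_ge0 ?(ltW e0) //.
rewrite key exprMn rn_kappa lerBlDr -mulrDl.
have t0 := tail_mass_gt0 m.+1; set B := (_ * tail mass _).
have B0 : 0 <= B by rewrite mulr_ge0 ?(ltW t0) // addr_ge0 ?sqr_ge0.
(* The square root is taken so that the bound on the partial sums passes to the limit through
   [rn_le_cvg]. *)
rewrite -(sqr_sqrtr B0) ler_sqr ?nnegrE ?rn_ge0 ?sqrtr_ge0 //.
have cb := create_bounded F u.
have /rn_le_cvg : (fun N => create F u (S m.+1 N)) @ \oo --> create F u (kappa m.+1).
  apply: cvg_comp (kappa_cvg m.+1) _; exact: (bounded_linearP cb.1).2 cb _.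
apply=> N; rewrite -[leLHS]ger0_norm ?rn_ge0 // -sqrtr_sqr ler_wsqrtr // sq.
apply: le_trans (_ : (e ^+ 2 + rn c ^+ 2) * \sum_(m.+1 <= n < N) mass n <= _).
  rewrite mulr_sumr; apply: ler_sum_nat => n /andP[mn _].
  rewrite mulrC ler_wpM2r //; have /= := hM n (leq_trans Mm (ltnW mn)).
  by rewrite ler_norml => /andP[+ _]; rewrite lerNl opprB lerBlDr.
by rewrite ler_wpM2l ?addr_ge0 ?sqr_ge0 ?(ltW e2) //; exact: tail_ge.
Qed.

Lemma approx_eigen_comp a b ca cb : bounded_linear a ->
  approx_eigen a ca -> approx_eigen b cb -> approx_eigen (a \o b) (ca * cb).
Proof.
move=> [la [C C0 hC]] ha hb.
have h := cvg0D (cvg0M C hb) (cvg0M (rn cb) ha).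
apply: (cvg0_squeeze h) => m.
rewrite divr_ge0 ?rn_ge0 //= [_ / _ * C]mulrAC [_ / _ * rn cb]mulrAC -mulrDl.
rewrite ler_wpM2r ?invr_ge0 ?rn_ge0 //.
have -> : a (b (kappa m)) - (ca * cb) *: kappa m =
   a (b (kappa m) - cb *: kappa m) + cb *: (a (kappa m) - ca *: kappa m).
  by rewrite (linB _ _ la) (linZ _ _ la) scalerBr scalerA mulrC addrA subrK.
apply: le_trans (rnD _ _) _; rewrite lerD //; first by rewrite mulrC.
by rewrite rnZ mulrC.
Qed.

Lemma approx_eigen_lin k a b ca cb :
  approx_eigen a ca -> approx_eigen b cb -> approx_eigen (k *: a + b) (k * ca + cb).
Proof.
move=> ha hb; have h := cvg0D (cvg0M (rn k) ha) hb.
apply: (cvg0_squeeze h) => m.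
rewrite divr_ge0 ?rn_ge0 //= [_ / _ * rn k]mulrAC -mulrDl.
rewrite ler_wpM2r ?invr_ge0 ?rn_ge0 // !fctE.
have -> : k *: a (kappa m) + b (kappa m) - (k * ca + cb) *: kappa m =
   k *: (a (kappa m) - ca *: kappa m) + (b (kappa m) - cb *: kappa m).
  by rewrite scalerBr scalerA scalerDl opprD addrACA.
by apply: le_trans (rnD _ _) _; rewrite rnZ mulrC.
Qed.

Lemma approx_eigen_id : approx_eigen idfun 1.
Proof.
rewrite /approx_eigen; under eq_fun do rewrite /= scale1r subrr rn0 mul0r.
exact: cvg_cst.
Qed.

Lemma approx_eigen0 : approx_eigen 0 0.
Proof.
rewrite /approx_eigen; under eq_fun do rewrite scale0r subr0 rn0 mul0r.
exact: cvg_cst.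
Qed.

(** The expectation value differs from [c] by <kappa, a kappa - c kappa> / |kappa|^2, which
    Cauchy-Schwarz bounds by the relative error. *)
Lemma approx_eigen_lim a c : approx_eigen a c ->
  limn (fun m => inner (kappa m) (a (kappa m)) / `|kappa m| ^+ 2) = c.
Proof.
move=> ha; apply: cvg_lim; first exact: norm_hausdorff.
apply/cvg_rn; apply: (cvg0_squeeze ha) => m.
rewrite rn_ge0 /=.
have k0 := rn_kappa_gt0 m.
have k0' : `|kappa m| ^+ 2 != 0 by rewrite expf_neq0 // normE_rn fmorph_eq0 gt_eqF.
have -> : c - inner (kappa m) (a (kappa m)) / `|kappa m| ^+ 2 =
    - inner (kappa m) (a (kappa m) - c *: kappa m) * (((rn (kappa m))^-1) ^+ 2)%:C.
  rewrite innerBr innerZr inner_norm normE_rn rmorphXn fmorphV /=.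
  by field; rewrite fmorph_eq0 gt_eqF.
rewrite rnM rnN rnC ger0_norm ?sqr_ge0 //.
apply: le_trans (ler_wpM2r _ (inner_cauchy_schwarz _ _)) _; first exact: sqr_ge0.
by rewrite le_eqVlt; apply/orP; left; apply/eqP; field; rewrite gt_eqF.
Qed.

End Coherent.

(** * Summability and slow growth of the weights *)

Section Weights.
Context {R : realType} (tau p : R).
Hypotheses (tau_gt0 : 0 < tau) (p_gt0 : 0 < p).
Let w := weight tau p.

Lemma weight_gt0 n : 0 < w n.
Proof. exact: expR_gt0. Qed.

(** With k > 2/p and b = 2 tau / k, w(n)^2 = exp(b n^p)^k >= (b n^p)^k >= b^k n^2 for n >= 1; the
    comparison series is the telescoping D / ((n+1)(n+2)). *)
Lemma cvg_series_weight : cvgn (series (fun n => (w n) ^- 2)).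
Proof.
have p2 : 0 < 2 / p by rewrite divr_gt0.
pose k := Num.bound (2 / p); have pk2 := archi_boundP (ltW p2).
have pk : 2 <= p * k%:R by rewrite mulrC -ler_pdivrMr // ltW.
have k0 : 0 < k%:R :> R by apply: lt_trans pk2.
pose b := 2 * tau / k%:R; have b0 : 0 < b by rewrite divr_gt0 // mulr_gt0.
have bk0 : 0 < b ^+ k by rewrite exprn_gt0.
(* The 2 serves n = 0, where w = 1; the 6 comes from (n+1)(n+2) <= 6 n^2 for n >= 1. *)
pose D := 2 + 6 / b ^+ k.
have D0 : 0 < D by rewrite addr_gt0 // divr_gt0.
apply: (@series_le_cvg _ _ (telescope (fun n => - (D * harmonic n)))).
- by move=> n; rewrite invr_ge0 exprn_ge0 // ltW // weight_gt0.
- move=> n; rewrite /telescope /= opprK addrC subr_ge0 ler_pM2l //.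
  by rewrite lef_pV2 ?posrE ?ltr0n // ler_nat.
- move=> n; have -> : telescope (fun n => - (D * harmonic n)) n =
      D / (n.+1%:R * n.+2%:R).
    rewrite /telescope /= /harmonic /=; field.
    by rewrite -[2 + _]/(2%:R + _) -natrD nat1r !pnatr_eq0.
  have nn0 : 0 < n.+1%:R * n.+2%:R :> R by rewrite mulr_gt0 // ltr0n.
  rewrite ler_pdivlMr // mulrC ler_pdivrMr ?exprn_gt0 ?weight_gt0 //.
  case: n nn0 => [|n] nn0.
    rewrite /w /weight powR0 ?gt_eqF // mulr0 expR0 expr1n mulr1 mul1r /D.
    by rewrite lerDl divr_ge0 // ltW.
  have n1 : 1 <= n.+1%:R :> R by rewrite ler1n.
  have wn : b ^+ k * n.+1%:R ^+ 2 <= w n.+1 ^+ 2.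
    have -> : w n.+1 ^+ 2 = expR (b * n.+1%:R `^ p) ^+ k.
      rewrite /w /weight -!expRM_natl; congr expR; rewrite /b; field.
      by rewrite gt_eqF.
    apply: le_trans (_ : (b * n.+1%:R `^ p) ^+ k <= _); last first.
      apply: lerXn2r; rewrite ?nnegrE ?expR_ge0 ?mulr_ge0 ?powR_ge0 ?(ltW b0) ?(ltW tau_gt0) //.
      by apply: (le_trans _ (expR_ge1Dx _)); rewrite lerDr.
    rewrite [leRHS]exprMn ler_wpM2l ?(ltW bk0) //.
    rewrite -[leRHS]powR_mulrn ?powR_ge0 // -powRrM -powR_mulrn ?ler0n //.
    exact: ler_powR.
  apply: le_trans (_ : 6 / b ^+ k * (b ^+ k * n.+1%:R ^+ 2) <= _); last first.
    apply: ler_pM; rewrite ?divr_ge0 ?mulr_ge0 ?sqr_ge0 ?(ltW bk0) //.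
    by rewrite /D lerDr.
  have e2 : n.+2%:R = n.+1%:R + 1 :> R by rewrite natr1.
  have e3 : n.+3%:R = n.+1%:R + 2 :> R by rewrite -natrD addn2.
  rewrite mulrA divfK ?gt_eqF // e2 e3.
  by move: n1; set y := n.+1%:R => n1; nra.
- apply/cvg_ex; exists (0 - - (D * harmonic 0%N)); rewrite telescopeK.
  apply: cvgB; last exact: cvg_cst.
  rewrite -oppr0 -(mulr0 D); apply: cvgN; apply: cvgM; first exact: cvg_cst.
  exact: cvg_harmonic.
Qed.

Hypothesis p_lt1 : p < 1.

(** For m >= 1, (m+1)^p - m^p = m^p ((1 + 1/m)^p - 1) <= m^(p-1), since y^p <= y for y >= 1. The
    sequence is shifted by one so that m = n+1 can be divided by. *)
Lemma weight_ratio : (fun n => w n.+1 / w n) @ \oo --> (1 : R).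
Proof.
have -> : (fun n => w n.+1 / w n) =
    (fun n => expR (tau * (n.+1%:R `^ p - n%:R `^ p))).
  by apply/funext => n; rewrite mulrBr expRB.
rewrite -cvg_shiftS.
suff h0 : (fun n => n.+2%:R `^ p - n.+1%:R `^ p) @ \oo --> (0 : R).
  have h1 : (fun n => tau * (n.+2%:R `^ p - n.+1%:R `^ p)) @ \oo --> tau * 0.
    by apply: cvgM; [exact: cvg_cst | exact: h0].
  have h2 : (fun n => expR (tau * (n.+2%:R `^ p - n.+1%:R `^ p))) @ \oo --> expR (tau * 0).
    by apply: continuous_cvg h1; exact: continuous_expR.
  by rewrite mulr0 expR0 in h2; exact: h2.
have h : (fun n => (harmonic n : R) `^ (1 - p)) @ \oo --> (0 : R).
  have q0 : 0 < 1 - p by rewrite subr_gt0.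
  move/cvg_at_rightP : (powR_cvg0 q0); apply; split; last exact: cvg_harmonic.
  by move=> n; rewrite invr_gt0 ltr0n.
apply: (cvg0_squeeze h) => n.
have n0 : 0 < n.+1%:R :> R by rewrite ltr0n.
rewrite subr_ge0 ge0_ler_powR ?nnegrE ?ler0n ?ler_nat ?(ltW p_gt0) //=.
have -> : (harmonic n : R) `^ (1 - p) = n.+1%:R `^ p / n.+1%:R.
  rewrite /harmonic /= -powR_inv1 ?ler0n // -powRrM mulN1r opprB.
  rewrite powRB; last by rewrite (gt_eqF n0) implybT.
  by rewrite powRr1 ?ler0n // powR_inv1 ?ler0n.
have -> : n.+2%:R = n.+1%:R * (1 + n.+1%:R^-1) :> R.
  by rewrite mulrDr mulr1 divff ?gt_eqF // natr1.
have y1 : 1 <= 1 + n.+1%:R^-1 :> R by rewrite lerDl invr_ge0 ler0n.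
rewrite powRM ?ler0n ?(le_trans ler01 y1) // lerBlDr.
apply: le_trans (ler_wpM2l (powR_ge0 _ _) (ler1_powR y1 (ltW p_lt1))) _.
by rewrite mulrDr mulr1 addrC.
Qed.

End Weights.

(** * Density in Hilbert tensor products *)

Section TensorProduct.
Context {R : realType} {U V : hilbertType R} (K : hilbert_tensor U V).

Lemma rn_tensor u v : rn (tensor K u v) = rn u * rn v.
Proof.
apply/eqP; rewrite -(@eqrXn2 _ 2) ?rn_ge0 ?mulr_ge0 ?rn_ge0 //.
apply/eqP/complexI; rewrite -inner_rn tensor_inner !inner_rn.
by rewrite exprMn [RHS]rmorphM.
Qed.

Lemma tensor_boundedl v : bounded_linear (tensor K ^~ v).
Proof.
split; first exact: tensor_linearl.
by exists (rn v) => [|u]; rewrite ?rn_ge0 // rn_tensor mulrC.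
Qed.

Lemma tensor_boundedr u : bounded_linear (tensor K u).
Proof.
split; first exact: tensor_linearr.
by exists (rn u) => [|v]; rewrite ?rn_ge0 // rn_tensor.
Qed.

(** The right factor is approximated in [W] while the left one is a generator; linearity and a
    second approximation then free the left factor. *)
Lemma tensor_dense (G : set U) (W : set V) :
  (forall u, cl (lspan G) u) -> (forall v, cl W v) ->
  forall t, cl (lspan [set tensor K u v | u in G & v in W]) t.
Proof.
move=> dG dW; set L := lspan _.
have Lc : linear_subspace (cl L) by apply: cl_subspace; exact: lspan_subspace.
have hG u v : G u -> cl L (tensor K u v).
  move=> Gu; apply: cl_idem => e e0.
  apply: (bounded_linear_cl (tensor_boundedr u) (dW v) _ e0) => _ [y Wy <-].
  by apply: sub_cl; apply: lspan_gen; exists u => //; exists y.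
have hs u v : lspan G u -> cl L (tensor K u v).
  move: u; apply: lspan_min => [|u]; last exact: hG.
  have [lt _] := tensor_boundedl v; case: Lc => L0 L1.
  split; first by rewrite (lin0 lt).
  by move=> a x y hx hy; rewrite lt; exact: L1.
have hu u v : cl L (tensor K u v).
  apply: cl_idem => e e0.
  apply: (bounded_linear_cl (tensor_boundedl v) (dG u) _ e0) => _ [y Gy <-].
  exact: hs.
move=> t; apply: cl_idem; apply: cl_mono ((dense_cl _).1 (@tensor_total _ _ _ K) t).
by apply: lspan_min => // _ [u _ [v _ <-]].
Qed.

End TensorProduct.

(** * The vector field as a derivation on complex functions *)

Section VectorFieldDerivative.
Context {R : realType} {d : nat} {X : topologicalType} {M : smooth_manifold R d X}.
Variable v : vector_field M.
Implicit Types (f g : X -> R[i]) (h k : X -> R).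

(** Derivability only along [v] and in the chart chosen at [x], which is what [der_real] evaluates;
    without it the directional derivative is no longer known to obey the sum and product rules. *)
Definition der_at h (x : X) :=
  derivable (h \o param (chart_at M x)) (chart (chart_at M x) x)
    (vf v (chart_at M x) x).

Lemma param_chart x : param (chart_at M x) (chart (chart_at M x) x) = x.
Proof. by apply: chartK; exact: chart_atP. Qed.

Lemma der_atD h k x : der_at h x -> der_at k x -> der_at (fun y => h y + k y) x.
Proof. exact: derivableD. Qed.

Lemma der_realD h k x : der_at h x -> der_at k x ->
  der_real v (fun y => h y + k y) x = der_real v h x + der_real v k x.
Proof. exact: deriveD. Qed.

Lemma der_atN h x : der_at h x -> der_at (fun y => - h y) x.
Proof. exact: derivableN. Qed.

Lemma der_realN h x : der_at h x ->
  der_real v (fun y => - h y) x = - der_real v h x.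
Proof. exact: deriveN. Qed.

Lemma der_atM h k x : der_at h x -> der_at k x -> der_at (fun y => h y * k y) x.
Proof. exact: derivableM. Qed.

Lemma der_realM h k x : der_at h x -> der_at k x ->
  der_real v (fun y => h y * k y) x =
  h x * der_real v k x + k x * der_real v h x.
Proof. by move=> dh dk; rewrite /der_real deriveM //= param_chart. Qed.

Definition dable f := forall x, der_at (fun y => complex.Re (f y)) x /\
  der_at (fun y => complex.Im (f y)) x.

Lemma dable_cst c : dable (fun=> c).
Proof. by move=> x; split; exact: derivable_cst. Qed.

Lemma der_cst c : der v (fun=> c) = fun=> 0.
Proof.
by apply/funext => x; rewrite /der /der_real !derive_cst.
Qed.

Lemma dableM f g : dable f -> dable g -> dable (fun x => f x * g x).
Proof.
move=> df dg x; have [fr fi] := df x; have [gr gi] := dg x; split.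
  have -> : (fun y => complex.Re (f y * g y)) = (fun y =>
    complex.Re (f y) * complex.Re (g y) + - (complex.Im (f y) * complex.Im (g y))).
    by apply/funext => y; case: (f y) (g y) => ? ? [? ?].
  by apply: der_atD; [exact: der_atM | apply: der_atN; exact: der_atM].
have -> : (fun y => complex.Im (f y * g y)) = (fun y =>
    complex.Re (f y) * complex.Im (g y) + complex.Im (f y) * complex.Re (g y)).
  by apply/funext => y; case: (f y) (g y) => ? ? [? ?].
by apply: der_atD; exact: der_atM.
Qed.

Lemma derM f g : dable f -> dable g ->
  der v (fun x => f x * g x) = (fun x => der v f x * g x + f x * der v g x).
Proof.
move=> df dg; apply/funext => x; have [fr fi] := df x; have [gr gi] := dg x.
rewrite /der.
have -> : (fun y => complex.Re (f y * g y)) = (fun y =>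
    complex.Re (f y) * complex.Re (g y) + - (complex.Im (f y) * complex.Im (g y))).
  by apply/funext => y; case: (f y) (g y) => ? ? [? ?].
have -> : (fun y => complex.Im (f y * g y)) = (fun y =>
    complex.Re (f y) * complex.Im (g y) + complex.Im (f y) * complex.Re (g y)).
  by apply/funext => y; case: (f y) (g y) => ? ? [? ?].
rewrite (der_realD (der_atM fr gr) (der_atN (der_atM fi gi))).
rewrite (der_realN (der_atM fi gi)) (der_realM fr gr) (der_realM fi gi).
rewrite (der_realD (der_atM fr gi) (der_atM fi gr)) (der_realM fr gi) (der_realM fi gr).
apply/eqP; rewrite eq_complex /=; apply/andP; split; apply/eqP;
  by case: (f x) (g x) => ? ? [? ?] /=; ring.
Qed.

Lemma dableD f g : dable f -> dable g -> dable (fun x => f x + g x).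
Proof.
move=> df dg x; have [fr fi] := df x; have [gr gi] := dg x; split.
  have -> : (fun y => complex.Re (f y + g y)) =
      (fun y => complex.Re (f y) + complex.Re (g y)).
    by apply/funext => y; case: (f y) (g y) => ? ? [? ?].
  exact: der_atD.
have -> : (fun y => complex.Im (f y + g y)) =
    (fun y => complex.Im (f y) + complex.Im (g y)).
  by apply/funext => y; case: (f y) (g y) => ? ? [? ?].
exact: der_atD.
Qed.

Lemma derD f g : dable f -> dable g ->
  der v (fun x => f x + g x) = (fun x => der v f x + der v g x).
Proof.
move=> df dg; apply/funext => x; have [fr fi] := df x; have [gr gi] := dg x.
rewrite /der.
have -> : (fun y => complex.Re (f y + g y)) =
    (fun y => complex.Re (f y) + complex.Re (g y)).
  by apply/funext => y; case: (f y) (g y) => ? ? [? ?].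
have -> : (fun y => complex.Im (f y + g y)) =
    (fun y => complex.Im (f y) + complex.Im (g y)).
  by apply/funext => y; case: (f y) (g y) => ? ? [? ?].
by rewrite (der_realD fr gr) (der_realD fi gi).
Qed.

Lemma dable_lin a f g : dable f -> dable g -> dable (fun x => a * f x + g x).
Proof.
by move=> df dg; apply: dableD => //; apply: dableM => //; exact: dable_cst.
Qed.

Lemma der_lin a f g : dable f -> dable g ->
  der v (fun x => a * f x + g x) = (fun x => a * der v f x + der v g x).
Proof.
move=> df dg; have da := dable_cst a.
rewrite derD //; last exact: dableM.
rewrite derM // der_cst; apply/funext => x; by rewrite mul0r add0r.
Qed.

Lemma dable_conj f : dable f -> dable (fun x => (f x)^*%C).
Proof.
move=> df x; have [fr fi] := df x; split.
  rewrite (_ : (fun y => _) = (fun y => complex.Re (f y))) //.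
  by apply/funext => y; case: (f y).
rewrite (_ : (fun y => _) = (fun y => - complex.Im (f y))); first exact: der_atN.
by apply/funext => y; case: (f y).
Qed.

Lemma der_conj f : dable f ->
  der v (fun x => (f x)^*%C) = (fun x => (der v f x)^*%C).
Proof.
move=> df; apply/funext => x; have [fr fi] := df x; rewrite /der /=.
have -> : (fun y => complex.Re (f y)^*%C) = (fun y => complex.Re (f y)).
  by apply/funext => y; case: (f y).
have -> : (fun y => complex.Im (f y)^*%C) = (fun y => - complex.Im (f y)).
  by apply/funext => y; case: (f y).
by rewrite (der_realN fi).
Qed.

Lemma smooth_dable f : smooth_cfun M f -> dable f.
Proof.
move=> [sr si] x; split.
  have [_ /(_ (vf v (chart_at M x) x)) [h _]] := sr (chart_at M x) 1%N.
  by apply: h; exists x => //; exact: chart_atP.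
have [_ /(_ (vf v (chart_at M x) x)) [h _]] := si (chart_at M x) 1%N.
by apply: h; exists x => //; exact: chart_atP.
Qed.

End VectorFieldDerivative.

(** * Skewness of the amplified generator L and its action on E_n f *)

Section AmplifiedGenerator.
Context {R : realType} {d : nat} {X : topologicalType} {M : smooth_manifold R d X}.
Context (v : vector_field M) (H : rkhs M) (Hinf : set H).
Hypothesis gen : generator_assumptions v Hinf.
Context {l2 : ell2 R} (K : hilbert_tensor l2 H).

(** Membership in the domain of V keeps [opapp] away from its default value 0. *)
Lemma VV_vf f x : Hinf f -> ev (VV v false f) x = der v (ev f) x.
Proof.
move=> /(Hinf_dom gen) [Vf _].
by have /= -> := @xgetPex _ 0 [set w | Vop v (f, w)] Vf.
Qed.

Lemma inner_VV f g : Hinf f -> Hinf g ->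
  inner g (VV v false f) = inner (VV v true g) f.
Proof.
move=> /(Hinf_dom gen) [Vf _] /(Hinf_dom gen) [_ Vg].
have /= h := @xgetPex _ 0 [set w | adjoint (Vop v (H := H)) (g, w)] Vg.
by apply: h; exact: (@xgetPex _ 0 [set w | Vop v (f, w)] Vf).
Qed.

Lemma inner_VVC f g : Hinf f -> Hinf g ->
  inner g (VV v true f) = inner (VV v false g) f.
Proof. by move=> hf hg; rewrite innerC -inner_VV // -innerC. Qed.

Lemma conj_half : conjc (2^-1)%R = (2^-1)%R :> R[i].
Proof. by rewrite conjc_inv conjc_nat. Qed.

Lemma inner_Aop f g : Hinf f -> Hinf g -> inner g (Aop v f) = - inner (Aop v g) f.
Proof.
move=> hf hg; rewrite /Aop innerZr innerZl conj_half innerBr innerBl.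
by rewrite inner_VV // inner_VVC //; ring.
Qed.

Lemma inner_Sop f g : Hinf f -> Hinf g -> inner g (Sop v f) = inner (Sop v g) f.
Proof.
move=> hf hg; rewrite /Sop innerZr innerZl conj_half innerDr innerDl.
by rewrite inner_VV // inner_VVC // addrC.
Qed.

Lemma Aop_Sop (f : H) : Aop v f + Sop v f = VV v false f.
Proof.
rewrite /Aop /Sop -scalerDr addrACA addNr addr0 scalerDr -scalerDl.
by rewrite (_ : (2^-1 + 2^-1)%R = 1) ?scale1r //; field.
Qed.

Definition Lvec j (f : H) : K := \sum_(i < j.+1)
  (tensor K (matrix_unit i i.+1 (ebasis l2 j)) (Sop v f)
   + tensor K (matrix_unit i i (ebasis l2 j)) (Aop v f)
   - tensor K (matrix_unit i.+1 i (ebasis l2 j)) (Sop v f)).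

Lemma inner_tensor_unit k g i m j f :
  inner (tensor K (ebasis l2 k) g) (tensor K (matrix_unit i m (ebasis l2 j)) f) =
  (m == j)%:R * (k == i)%:R * inner g f.
Proof. by rewrite tensor_inner innerZr !ebasis_orthonormal. Qed.

(** The block matrix of L: row k has S in column k+1, A on the diagonal and -S in column k-1. *)
Lemma inner_Lvec k g j f : inner (tensor K (ebasis l2 k) g) (Lvec j f) =
  (k.+1 == j)%:R * inner g (Sop v f) + (k == j)%:R * inner g (Aop v f)
  - (k == j.+1)%:R * inner g (Sop v f).
Proof.
rewrite inner_sumr.
under eq_bigr do rewrite innerBr innerDr !inner_tensor_unit.
rewrite sumrB big_split /= -!mulr_suml.
(* [q] tests the column and [r] the row of a matrix unit: only [i0] passes the column test, and [b]
   tells whether it passes the row test. *)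
have e (q r : nat -> bool) b i0 : (i0 < j.+1)%N ->
    (forall i : nat, q i && r i = (i == i0) && b) ->
    \sum_(i < j.+1) (q i)%:R * (r i)%:R = b%:R :> R[i].
  move=> i0j h; rewrite (bigD1 (Ordinal i0j)) //= big1 ?addr0 => [|i ii0].
    by rewrite -natrM mulnb h eqxx.
  by rewrite -natrM mulnb h; move: ii0; rewrite -val_eqE /= => /negPf ->.
have e0 (q r : nat -> bool) :
    (forall i : 'I_j.+1, q i && r i = false) ->
    \sum_(i < j.+1) (q i)%:R * (r i)%:R = 0 :> R[i].
  by move=> h; rewrite big1 // => i _; rewrite -natrM mulnb h.
congr (_ * _ + _ * _ - _ * _).
(* Column 0 has no entry above the diagonal. *)
- case: j e e0 => [|j] e e0.
    by rewrite (e0 (fun i => i.+1 == 0)%N (fun i => k == i)).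
  apply: (e (fun i => i.+1 == j.+1)%N (fun i => k == i) _ j) => // i.
  by rewrite eqSS; case: eqP => // ->; rewrite eqSS.
- apply: (e (fun i => i == j)%N (fun i => k == i) _ j) => // i.
  by case: eqP => // ->.
- apply: (e (fun i => i == j)%N (fun i => k == i.+1) _ j) => // i.
  by case: eqP => // ->.
Qed.

(** The diagonal blocks A are skew; S is symmetric, and transposition exchanges its occurrences
    above and below the diagonal, which have opposite signs. *)
Lemma Lvec_skew k g j f : Hinf f -> Hinf g ->
  inner (tensor K (ebasis l2 k) g) (Lvec j f) =
  - inner (Lvec k g) (tensor K (ebasis l2 j) f).
Proof.
move=> hf hg; rewrite inner_Lvec (innerC (tensor K (ebasis l2 j) f)) inner_Lvec.
rewrite rmorphB rmorphD /= !conjcM !conjc_nat -!innerC inner_Sop // inner_Aop //.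
rewrite [j == k]eq_sym [j.+1 == k]eq_sym [j == k.+1]eq_sym; ring.
Qed.

Lemma Lop_Lvec j f : Hinf f ->
  Lop v Hinf (tensor K (ebasis l2 j) f, Lvec j f).
Proof. by move=> hf; apply: lspan_gen; exists j, f. Qed.

Lemma Lop_skew (p q : K * K) : Lop v Hinf p -> Lop v Hinf q ->
  inner p.1 q.2 = - inner p.2 q.1.
Proof.
move=> Dp; move: q; apply: lspan_min.
  split=> [|a s t hs ht]; first by rewrite /= !inner0r oppr0.
  by rewrite /= !inner_linear hs ht opprD mulrN.
move=> _ [j [f [hf ->]]] /=; move: p Dp; apply: lspan_min.
  split=> [|a s t hs ht]; first by rewrite /= !inner0l oppr0.
  by rewrite /= !innerDl !innerZl hs ht opprD mulrN.
by move=> _ [k [g [hg ->]]] /=; exact: Lvec_skew.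
Qed.

Lemma K0_dense (t : K) : cl (K0 Hinf) t.
Proof.
have hK : lspan [set tensor K u f | u in range (ebasis l2) & f in Hinf] `<=` K0 Hinf.
  apply: lspan_min; first exact: lspan_subspace.
  by move=> _ [_ [j _ <-] [f hf <-]]; apply: lspan_gen; exists j => //; exists f.
apply: (cl_mono hK); apply: tensor_dense.
  exact: (dense_cl _).1 (@ebasis_total _ l2).
exact: (dense_cl _).1 (Hinf_dense gen).
Qed.

Lemma K0_opdom : K0 Hinf `<=` opdom (Lop v Hinf (K := K)).
Proof.
apply: lspan_min.
  have [L0 L1] := lspan_subspace [set p : K * K | exists j f, Hinf f /\
    p = (tensor K (ebasis l2 j) f, Lvec j f)].
  split; first by exists 0.
  by move=> a s t [s' hs] [t' ht]; exists (a *: s' + t'); exact: L1 hs ht.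
by move=> _ [j _ [f hf <-]]; exists (Lvec j f); exact: Lop_Lvec.
Qed.

Lemma Lop_dense (t : K) : cl (opdom (Lop v Hinf (K := K))) t.
Proof. exact: cl_mono K0_opdom _ (K0_dense t). Qed.

Lemma opapp_Lop_skew (s t : K) : K0 Hinf s -> K0 Hinf t ->
  inner s (opapp (Lop v Hinf) t) = - inner (opapp (Lop v Hinf) s) t.
Proof.
move=> /K0_opdom hs /K0_opdom ht.
exact: (Lop_skew (opappP Lop_skew Lop_dense hs) (opappP Lop_skew Lop_dense ht)).
Qed.

Lemma K0_Emb n f : Hinf f -> K0 Hinf (Emb n f : K).
Proof.
move=> hf; have Ks : linear_subspace (K0 Hinf (K := K)) by exact: lspan_subspace.
rewrite /Emb; apply: (subspace_sum _ Ks) => i _; apply: (subspaceZ _ Ks).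
by apply: lspan_gen; exists i => //; exists f.
Qed.

Lemma opapp_Lop_Emb n f : Hinf f ->
  opapp (Lop v Hinf) (Emb n f : K) = \sum_(i < n) (fib i.+1)%:R *: Lvec i f.
Proof.
move=> hf; apply: (opapp_skew Lop_skew Lop_dense).
have Ls : linear_subspace (Lop v Hinf (K := K)) by exact: lspan_subspace.
rewrite [X in Lop _ _ X](_ : _ =
    \sum_(i < n) (fib i.+1)%:R *: (tensor K (ebasis l2 i) f, Lvec i f)).
  apply: (subspace_sum _ Ls) => i _; apply: (subspaceZ _ Ls); exact: Lop_Lvec.
rewrite [RHS]surjective_pairing (big_morph (fst : K * K -> K) (id1 := 0) (op1 := +%R)) //.
by rewrite (big_morph (snd : K * K -> K) (id1 := 0) (op1 := +%R)).
Qed.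

Definition coherent (x : X) : K := tensor K (ebasis l2 0%N) (kersec H x).

Lemma inner_coherent_Emb n f x : (0 < n)%N ->
  inner (coherent x) (Emb n f) = ev f x.
Proof.
case: n => // n _; rewrite inner_sumr big_ord_recl big1 ?addr0 => [|i _].
  by rewrite innerZr tensor_inner ebasis_orthonormal eqxx !mul1r -reproducing.
by rewrite innerZr tensor_inner ebasis_orthonormal mul0r mulr0.
Qed.

Lemma inner_coherent_LEmb n f x : (1 < n)%N -> Hinf f ->
  inner (coherent x) (opapp (Lop v Hinf) (Emb n f)) = der v (ev f) x.
Proof.
move=> n1 hf; rewrite opapp_Lop_Emb // inner_sumr.
(* Row 0 of the block matrix meets only the columns 0 and 1, hence the two summands split off. *)
case: n n1 => [|[|n]] // _; rewrite !big_ord_recl big1 => [|i _].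
  rewrite !innerZr !inner_Lvec /= !mul1r !mul0r add0r subr0 !addr0 subr0.
  by rewrite -innerDr Aop_Sop -reproducing VV_vf.
by rewrite innerZr inner_Lvec /= !mul0r add0r subr0 mulr0.
Qed.

End AmplifiedGenerator.

(** * Symbols of operators and of their commutators *)

Section CoherentSymbols.
Context {R : realType} {d : nat} {X : topologicalType} {M : smooth_manifold R d X}.
Context (v : vector_field M) {U : hilbertType R} {w : nat -> R}.
Context {T : forall n, tensor_power U n} {F : fock_space w T}.
Hypothesis w_gt0 : forall n, 0 < w n.
Hypothesis w_sum : cvgn (series (fun n => (w n) ^- 2)).
Context (xi : X -> U).
Hypothesis xi1 : forall x, rn (xi x) = 1.
Context (D : set (F * F)).
Hypothesis D0 : D (0, 0).
Hypothesis D_lin : forall a p q, D p -> D q -> D (a *: p + q).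

(* The commutator [B] of D with [a] is carried along with [a], so that the Leibniz
   rules of [D, .] and of [der v] can be matched product by product. *)
Record has_symbol (a B : F -> F) (f : X -> R[i]) : Prop := HasSymbol {
  symbol_bounded : bounded_linear a;
  symbol_comm_bounded : bounded_linear B;
  symbol_comm : commutator_on D a B;
  symbol_eigen : forall x, approx_eigen (xi x) a (f x);
  symbol_comm_eigen : forall x, approx_eigen (xi x) B (der v f x);
  symbol_dable : dable v f }.

Lemma has_symbol_lin k a b B C f g : has_symbol a B f -> has_symbol b C g ->
  has_symbol (k *: a + b) (k *: B + C) (fun x => k * f x + g x).
Proof.
move=> [ba bB cB ef dB df] [bb bC cC eg dC dg]; split.
- exact: bounded_linear_lin.
- exact: bounded_linear_lin.
- move=> u z uz; rewrite !fctE addrACA -scalerDr.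
  exact: D_lin (cB _ _ uz) (cC _ _ uz).
- by move=> x; exact: approx_eigen_lin.
- by move=> x; rewrite der_lin //; exact: approx_eigen_lin.
- exact: dable_lin.
Qed.

Lemma has_symbol_comp a b B C f g : has_symbol a B f -> has_symbol b C g ->
  has_symbol (a \o b) ((B \o b) + (a \o C)) (fun x => f x * g x).
Proof.
move=> [ba bB cB ef dB df] [bb bC cC eg dC dg]; split.
- exact: bounded_linear_comp.
- rewrite -[B \o b]scale1r.
  by apply: bounded_linear_lin; exact: bounded_linear_comp.
- move=> u z uz; rewrite !fctE /= -addrA -(linD _ _ ba.1).
  exact: cB _ _ (cC _ _ uz).
- by move=> x; exact: approx_eigen_comp.
- move=> x; rewrite derM // -[B \o b]scale1r -[der v f x * g x]mul1r.
  by apply: approx_eigen_lin; exact: approx_eigen_comp.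
- exact: dableM.
Qed.

Lemma has_symbol_id : has_symbol idfun 0 (fun=> 1).
Proof.
split.
- exact: bounded_linear_id.
- exact: bounded_linear0.
- by move=> u z uz; have -> : (0 : F -> F) u + idfun z = z by exact: add0r.
- by move=> x; exact: approx_eigen_id.
- by move=> x; rewrite der_cst; exact: approx_eigen0.
- exact: dable_cst.
Qed.

Lemma has_symbol0 : has_symbol 0 0 (fun=> 0).
Proof.
split.
- exact: bounded_linear0.
- exact: bounded_linear0.
- by move=> u z uz; have -> : (0 : F -> F) u + (0 : F -> F) z = 0 by exact: add0r.
- by move=> x; exact: approx_eigen0.
- by move=> x; rewrite der_cst; exact: approx_eigen0.
- exact: dable_cst.
Qed.

Lemma has_symbol_ext a B f g : f =1 g -> has_symbol a B f -> has_symbol a B g.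
Proof. by move=> /funext ->. Qed.

(** Closure under [adj] forces the adjoint and its commutator into the induction: being
    approximately an eigenvector of an operator does not by itself pass to the adjoint. *)
Definition star_symbol (a : F -> F) := exists b B C f,
  [/\ adjpair a b, has_symbol a B f & has_symbol b C (fun x => (f x)^*%C)].

Lemma star_symbol_lin k a b :
  star_symbol a -> star_symbol b -> star_symbol (k *: a + b).
Proof.
move=> [a' [B [B' [f [aa sa sa']]]]] [b' [C [C' [g [bb sb sb']]]]].
exists (k^*%C *: a' + b'), (k *: B + C), (k^*%C *: B' + C'), (fun x => k * f x + g x).
split; last 2 first.
- exact: has_symbol_lin.
- apply: has_symbol_ext (has_symbol_lin _ sa' sb') => x.
  by rewrite rmorphD /= conjcM.
move=> x y; rewrite !fctE innerDr innerDl innerZr innerZl conjcK aa bb //.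
Qed.

Lemma star_symbol_comp a b : star_symbol a -> star_symbol b -> star_symbol (a \o b).
Proof.
move=> [a' [B [B' [f [aa sa sa']]]]] [b' [C [C' [g [bb sb sb']]]]].
exists (b' \o a'), ((B \o b) + (a \o C)), ((C' \o a') + (b' \o B')), (fun x => f x * g x).
split; last 2 first.
- exact: has_symbol_comp.
- apply: has_symbol_ext (has_symbol_comp sb' sa') => x.
  by rewrite conjcM mulrC.
by move=> x y; rewrite /= aa bb.
Qed.

Lemma star_symbol_adj a : star_symbol a -> star_symbol (adj a).
Proof.
move=> [b [B [C [f [ab sa sb]]]]]; rewrite (adjpair_adj ab).
exists a, C, B, (fun x => (f x)^*%C); split => //; first exact: adjpair_sym.
by apply: has_symbol_ext sa => x; rewrite conjcK.
Qed.

Lemma star_symbol_id : star_symbol idfun.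
Proof.
exists idfun, 0, 0, (fun=> 1); split=> //; first exact: has_symbol_id.
by apply: has_symbol_ext has_symbol_id => x; rewrite conjc1.
Qed.

Lemma star_symbol0 : star_symbol 0.
Proof.
exists 0, 0, 0, (fun=> 0); split.
- by move=> x y; rewrite (_ : (0 : F -> F) y = 0) // inner0r (_ : (0 : F -> F) x = 0) // inner0l.
- exact: has_symbol0.
- by apply: has_symbol_ext has_symbol0 => x; rewrite conjc0.
Qed.

Lemma star_alg_symbol (G : set (F -> F)) : G `<=` star_symbol ->
  star_alg G `<=` star_symbol.
Proof.
move=> Gs a; apply; split=> //; split.
- by split; [exact: star_symbol0 | move=> k b c; exact: star_symbol_lin].
- exact: star_symbol_comp.
- exact: star_symbol_adj.
Qed.

End CoherentSymbols.

Theorem theorem25 (R : realType) (d : nat) (X : topologicalType)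
  (M : smooth_manifold R d X) (v : vector_field M)
  (Flow : R -> X -> X) (hFlow : flow_generated_by v Flow)
  (H : rkhs M)
  (Hinf : set H) (h1 : generator_assumptions v Hinf)
  (HH : hilbert_tensor H H) (S0 : set H) (h2 : algebra_assumptions Hinf HH S0)
  (h3 : normalized_kernel H)
  (l2 : ell2 R) (K : hilbert_tensor l2 H)
  (T : forall n : nat, tensor_power K n)
  (tau p : R) (htau : 0 < tau) (hp0 : 0 < p) (hp1 : p < 1)
  (F : fock_space (weight tau p) T)
  (n : nat) (hn : (2 <= n)%N) (a : F -> F) (ha : alg_n F S0 n a) :
  Psihat F (comm_ext (Dop v Hinf F) a) = der v (Psihat F a).
Proof.
have w0 := @weight_gt0 R tau p.
have ws := @cvg_series_weight R tau p htau hp0.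
have wr := @weight_ratio R tau p hp0 hp1.
pose W := K0 Hinf (K := K); pose l := opapp (Lop v Hinf (K := K)).
have Wd : forall t, cl W t := @K0_dense _ _ _ _ _ _ _ h1 _ K.
have ls s t : W s -> W t -> inner s (l t) = - inner (l s) t.
  exact: opapp_Lop_skew.
pose D := derivation (F := F) W l.
(* Both sides unfold to the same span. *)
have DE : Dop v Hinf F = D by [].
have x1 x : rn (coherent K x) = 1.
  rewrite rn_tensor [rn (kersec H x)]/rn (h3 x) mulr1; apply/eqP.
  by rewrite -(@eqrXn2 _ 2) ?rn_ge0 // rn_sqrE ebasis_orthonormal eqxx expr1n.
have [D0 D_lin] : linear_subspace D by exact: lspan_subspace.
have [b [B [C [f [ab sa sb]]]]] : star_symbol v (coherent K) D a.
  move: ha; apply: star_alg_symbol => // _ [->|[g Sg <-]].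
    exact: star_symbol_id.
  have hg := S0_Hinf h2 Sg; set u := Emb n g.
  have Wu : W u by exact: K0_Emb.
  have df : dable v (ev g) by apply: smooth_dable; exact: ev_smooth.
  have n0 := ltnW hn.
  (* The generators of [alg_n] are annihilation operators, whose symbols are conjugates; the
     unconjugated function belongs to the adjoint [create F u]. *)
  exists (create F u), (annihilate F (l u)), (create F (l u)), (fun x => (ev g x)^*%C).
  split.
  - exact/adjpair_sym/annihilateP.
  - split; [exact: annihilate_bounded | exact: annihilate_bounded
           | exact: annihilate_commutator | | | exact: dable_conj].
    + by move=> x; rewrite -(inner_coherent_Emb K g x n0); exact: annihilate_approx.
    + move=> x; rewrite der_conj // -(inner_coherent_LEmb h1 K x hn hg).
      exact: annihilate_approx.
  - apply: (@has_symbol_ext _ _ _ _ _ _ _ _ _ _ _ _ _ (ev g)).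
      by move=> x; rewrite conjcK.
    split; [exact: create_bounded | exact: create_bounded
           | exact: create_commutator | | | exact: df].
    + by move=> x; rewrite -(inner_coherent_Emb K g x n0); exact: create_approx.
    + by move=> x; rewrite -(inner_coherent_LEmb h1 K x hn hg); exact: create_approx.
have [ba bB cB ef dB df] := sa.
have e1 : Psihat F a = f.
  by apply/funext => x; exact: (approx_eigen_lim w0 ws (x1 x) (ef x)).
(* The chosen extension [comm_ext] is the commutator [B] carried along, whose limit values [dB] are
   those of [der v f]. *)
rewrite e1 DE (comm_extE (derivation_skew ls) (derivation_dense w0 l Wd) bB cB).
by apply/funext => x; exact: (approx_eigen_lim w0 ws (x1 x) (dB x)).
Qed.
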